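(* An ABC voting rule $f$ (for fixed $m\ge 2$ and fixed committee size $k\in\{1,\dots,m-1\}$) is a Thiele rule if and only if it satisfies anonymity, neutrality, consistency, continuity, and independence of losers.
   Context: Let $\mathcal C=\{c_1,\dots,c_m\}$ be a set of $m\ge 2$ candidates and $\mathbb N=\{1,2,\dots\}$ the set of potential voters. An electorate is a non-empty finite $N\subseteq\mathbb N$. An approval ballot is a non-empty subset of $\mathcal C$; $\mathcal A$ is the set of all ballots. A profile is a map $A:N\to\mathcal A$ for some electorate $N=N_A$, with $A_i$ the ballot of voter $i$; $\mathcal A^*$ is the set of all profiles. Profiles $A,A'$ are disjoint if $N_A\cap N_{A'}=\emptyset$, and then $A+A'$ is the profile on $N_A\cup N_{A'}$ agreeing with $A$ on $N_A$ and with $A'$ on $N_{A'}$. For $\lambda\in\mathbb N$, $\lambda A$ denotes a profile consisting of $\lambda$ copies of $A$ on pairwise disjoint voter sets. Fix $k\in\{1,\dots,m-1\}$; $\mathcal W_k=\{W\subseteq\mathcal C:|W|=k\}$ is the set of committees. An ABC voting rule is a map $f:\mathcal A^*\to 2^{\mathcal W_k}\setminus\{\emptyset\}$. Axioms: $f$ is anonymous if $f(A)=f(\pi(A))$ for all $A$ and permutations $\pi$ of $\mathbb N$, where $\pi(A)$ has electorate $\pi(N_A)$ and $\pi(A)_{\pi(i)}=A_i$. $f$ is neutral if $f(\tau(A))=\{\tau(W):W\in f(A)\}$ for all $A$ and permutations $\tau$ of $\mathcal C$, where $\tau(A)_i=\tau(A_i)$. $f$ is consistent if $f(A+A')=f(A)\cap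 f(A')$ for all disjoint $A,A'$ with $f(A)\cap f(A')\neq\emptyset$. $f$ is continuous if for all profiles $A,A'$ there is $\lambda\in\mathbb N$ with $f(\lambda A+A')\subseteq f(A)$. $f$ is independent of losers if $W\in f(A)$ implies $W\in f(A')$ for all profiles $A,A'$ with $N_A=N_{A'}$ and committees $W$ such that $A'_i\subseteq A_i$ and $W\cap A'_i=W\cap A_i$ for all $i\in N_A$. A Thiele scoring function is a non-decreasing $s:\{0,\dots,k\}\to\mathbb R$ with $s(0)=0$. $f$ is a Thiele rule if there is a Thiele scoring function $s$ with $f(A)=\{W\in\mathcal W_k:\hat s(A,W)\ge\hat s(A,W')\ \forall W'\in\mathcal W_k\}$ for all $A$, where $\hat s(A,W)=\sum_{i\in N_A}s(|A_i\cap W|)$. *)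

(* Defs.v *)
From HB Require Import structures.
From mathcomp Require Import all_boot all_order all_algebra all_fingroup.
From mathcomp Require Import finmap.
From mathcomp Require Import reals.
Set Implicit Arguments. Unset Strict Implicit. Unset Printing Implicit Defensive.
Import Order.TTheory GRing.Theory Num.Theory.
Local Open Scope fset_scope.
Local Open Scope fmap_scope.

(* Candidates: 'I_m.  Voters: nat.  A ballot is a {set 'I_m}.
   A profile is a finite map from voters (nat) to ballots whose domain
   (the electorate) is nonempty and whose values are nonempty ballots. *)
Definition ballots (m : nat) := {fmap nat -> {set 'I_m}}.

Definition is_profile m (A : ballots m) : bool :=
  (domf A != fset0) && [forall x : domf A, A x != set0].

Definition is_ABC_rule m k (f : ballots m -> {set {set 'I_m}}) : Prop :=
  forall A, is_profile A ->
    f A != set0 /\ (forall W, W \in f A -> #|W| = k).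

Definition relabel m (pi : nat -> nat) (A B : ballots m) : Prop :=
  domf B = [fset pi i | i in domf A] /\
  forall i, i \in domf A -> B.[? pi i] = A.[? i].

Definition anonymous m (f : ballots m -> {set {set 'I_m}}) : Prop :=
  forall (pi : nat -> nat) (A B : ballots m),
    bijective pi -> is_profile A -> relabel pi A B -> f B = f A.

Definition cand_perm m (tau : {perm 'I_m}) (A : ballots m) : ballots m :=
  [fmap x : domf A => imset tau (mem (A x))].

Definition neutral m (f : ballots m -> {set {set 'I_m}}) : Prop :=
  forall (tau : {perm 'I_m}) (A : ballots m), is_profile A ->
    f (cand_perm tau A) = imset (fun W : {set 'I_m} => imset tau (mem W)) (mem (f A)).

Definition disjoint_prof m (A A' : ballots m) : bool :=
  domf A `&` domf A' == fset0.

(* A + A' is finmap concatenation (catf); for disjoint profiles it agrees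
   with A on N_A and with A' on N_A'. *)
Definition consistent m (f : ballots m -> {set {set 'I_m}}) : Prop :=
  forall A A' : ballots m, is_profile A -> is_profile A' ->
    disjoint_prof A A' -> f A :&: f A' != set0 ->
    f (A + A') = f A :&: f A'.

(* B consists of l copies of A on pairwise disjoint voter sets:
   copy j of voter i is voter g j i, g injective on [0,l) x N_A. *)
Definition copies m (l : nat) (A B : ballots m) : Prop :=
  exists g : nat -> nat -> nat,
    (forall j1 j2 i1 i2, (j1 < l)%N -> (j2 < l)%N ->
        i1 \in domf A -> i2 \in domf A -> g j1 i1 = g j2 i2 ->
        j1 = j2 /\ i1 = i2) /\
    (forall v, v \in domf B <->
        exists j i, (j < l)%N /\ i \in domf A /\ v = g j i) /\
    (forall j i, (j < l)%N -> i \in domf A -> B.[? g j i] = A.[? i]).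

Definition continuous m (f : ballots m -> {set {set 'I_m}}) : Prop :=
  forall A A' : ballots m, is_profile A -> is_profile A' ->
    exists l : nat, (0 < l)%N /\
      forall B : ballots m, copies l A B -> disjoint_prof B A' ->
        f (B + A') \subset f A.

Definition indep_losers m (f : ballots m -> {set {set 'I_m}}) : Prop :=
  forall (A A' : ballots m) (W : {set 'I_m}),
    is_profile A -> is_profile A' -> domf A = domf A' ->
    (forall i, i \in domf A -> forall (X X' : {set 'I_m}),
        A.[? i] = Some X -> A'.[? i] = Some X' ->
        X' \subset X /\ W :&: X' = W :&: X) ->
    W \in f A -> W \in f A'.

Local Open Scope ring_scope.

Definition thiele_score (R : realType) m (s : nat -> R) (A : ballots m)
    (W : {set 'I_m}) : R :=
  \sum_(x : domf A) s #|A x :&: W|.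

(* Thiele scoring function on {0..k}: s 0 = 0, non-decreasing on {0..k}
   (values of s outside {0..k} are never used). *)
Definition is_thiele_scoring (R : realType) (k : nat) (s : nat -> R) : Prop :=
  s 0%N = 0 /\ (forall i j, (i <= j <= k)%N -> s i <= s j).

Definition is_thiele_rule (R : realType) m k
    (f : ballots m -> {set {set 'I_m}}) : Prop :=
  exists s : nat -> R, is_thiele_scoring k s /\
    forall A : ballots m, is_profile A ->
      f A = [set W : {set 'I_m} | (#|W| == k) &&
               [forall W' : {set 'I_m}, (#|W'| == k) ==>
                  (thiele_score s A W' <= thiele_score s A W)]].

(* Main.v *)
Require Import Defs.
From HB Require Import structures.
From mathcomp Require Import all_boot all_order all_algebra all_fingroup.
From mathcomp Require Import finmap.
From mathcomp Require Import reals.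
From mathcomp Require Import boolp zify ring lra.
Set Implicit Arguments. Unset Strict Implicit. Unset Printing Implicit Defensive.
Import Order.TTheory GRing.Theory Num.Theory.

(** A rule satisfying the axioms depends only on ballot counts, and since the
    profile containing every ballot once elects all committees, it extends to
    signed counts [v].  For adjacent committees [a |: Z] and [b |: Z],
    independence of losers and averaging over the stabiliser of [Z], [a], [b]
    show that the comparison depends only on the numbers [d_l] of ballots [X]
    with [#|X :&: Z| = l] containing [a] but not [b], minus those containing [b]
    but not [a].  The [d] for which [a |: Z] may win form a cone containing the
    unit vectors, and M. Riesz extension gives a nonnegative functional [delta]
    on it; its partial sums are the scoring function [s].

    Local optimality is lifted to committees [W], [X] at distance [t >= 2] by
    induction on [t].  If [s] is linear this is a pairing argument.  Otherwise
    signed counts realise both linear and bilinear functions of a committee as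
    scores, in particular some [p] electing exactly [W] and [X].  If [W] won at
    [v] although [X] scores higher, subtracting a suitable multiple of [p] would
    let an intermediate committee overtake [W] but not [X], leaving [X] as the
    only winner; adding [p] back, [X] alone would win at [v].

    Hence every winner maximises the score; continuity gives the converse. *)

(** * Profiles as lists of ballots *)

Section Ballots.
Variable m : nat.
Implicit Types (A B : ballots m) (l : seq {set 'I_m}).

(** The default [set0] is not a legal ballot, so in a profile it only stands for absent voters. *)
Definition ballot A (i : nat) : {set 'I_m} := odflt set0 (A.[? i])%fmap.
Definition ballot_seq A : seq {set 'I_m} := [seq ballot A i | i <- domf A].
Definition valid l := (l != [::]) && (set0 \notin l).

Lemma fnd_ballot A i : i \in domf A -> (A.[? i])%fmap = Some (ballot A i).
Proof. by move=> iA; rewrite /ballot in_fnd. Qed.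

Lemma ballot_fsval A (x : domf A) : ballot A (fsval x) = A x.
Proof. by rewrite /ballot (in_fnd (fsvalP x)) /=; congr (A _); apply: val_inj. Qed.

Lemma is_profile_valid A : is_profile A = valid (ballot_seq A).
Proof.
rewrite /is_profile /valid; congr (_ && _).
  by rewrite -size_eq0 size_map size_eq0; congr negb.
apply/forallP/negP => [h /mapP[i iA e]|h x].
  by move: (h [` iA]%fset); rewrite -ballot_fsval /= -e eqxx.
apply/eqP => e; apply: h; apply/mapP; exists (fsval x); first exact: fsvalP.
by rewrite ballot_fsval.
Qed.

Lemma perm_ballot_seq A (s : seq nat) :
  uniq s -> s =i domf A -> perm_eq (ballot_seq A) (map (ballot A) s).
Proof.
by move=> us es; apply/perm_map/uniq_perm => [||i]; rewrite ?fset_uniq // es.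
Qed.

Lemma ballot_seq_cat A B : disjoint_prof A B ->
  perm_eq (ballot_seq (catf A B)) (ballot_seq A ++ ballot_seq B).
Proof.
move=> /eqP dAB; have dis i : i \in domf A -> i \notin domf B.
  move=> iA; apply/negP => iB.
  by have := in_fset0 i; rewrite -dAB inE iA iB.
have u : uniq (enum_fset (domf A) ++ enum_fset (domf B)).
  rewrite cat_uniq !fset_uniq andbT /=; apply/hasPn => i iB.
  by apply/negP => /dis; rewrite [_ \in _]iB.
apply: perm_trans (perm_ballot_seq u _) _.
  by move=> i; rewrite mem_cat mem_catf.
rewrite map_cat; apply/seq.permP => a; congr (count _ (_ ++ _)).
  by apply/eq_in_map => i iA; rewrite /ballot fnd_cat (negbTE (dis _ iA)).
by apply/eq_in_map => i iB; rewrite /ballot fnd_cat iB.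
Qed.

Lemma ballot_seq_copies n A B : copies n A B ->
  perm_eq (ballot_seq B) (flatten (nseq n (ballot_seq A))).
Proof.
move=> [g [ginj [gdom gval]]].
pose s := flatten [seq [seq g j i | i <- domf A] | j <- iota 0 n].
have us : uniq s.
  apply: allpairs_uniq_dep => [|j _|]; rewrite ?iota_uniq ?fset_uniq //.
  move=> _ _ /allpairsPdep[j1 [i1 [j1n i1A ->]]] /allpairsPdep[j2 [i2 [j2n i2A ->]]] /=.
  rewrite !mem_iota in j1n j2n.
  by case/(ginj _ _ _ _ j1n j2n i1A i2A) => -> ->.
have es : s =i domf B.
  move=> v; apply/allpairsPdep/idP => [[j [i [jn iA ->]]]|/gdom[j [i [jn [iA ->]]]]].
    by apply/gdom; exists j, i; rewrite mem_iota in jn.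
  by exists j, i; rewrite mem_iota.
apply: perm_trans (perm_ballot_seq us es) _; rewrite /s map_flatten -map_comp.
suff -> : [seq (map (ballot B) \o (fun j => [seq g j i | i <- domf A])) j | j <- iota 0 n]
  = nseq n (ballot_seq A) by [].
apply: (@eq_from_nth _ [::]) => [|j]; rewrite size_map size_iota ?size_nseq // => jn.
rewrite (nth_map 0) ?size_iota // nth_iota // nth_nseq jn /= -map_comp.
by apply/eq_in_map => i iA; rewrite /= /ballot gval.
Qed.

Lemma ballot_seq_relabel (pi : nat -> nat) A B : bijective pi -> relabel pi A B ->
  perm_eq (ballot_seq B) (ballot_seq A).
Proof.
move=> /bij_inj pinj [dB vB].
have u : uniq (map pi (domf A)) by rewrite map_inj_uniq ?fset_uniq.
apply: perm_trans (perm_ballot_seq u _) _.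
  move=> i; rewrite dB; apply/mapP/imfsetP => -[j jA ->]; by exists j.
rewrite -map_comp; apply/seq.permP => a; congr count.
by apply/eq_in_map => i iA; rewrite /= /ballot vB.
Qed.

Lemma ballot_seq_cand_perm (tau : {perm 'I_m}) A :
  ballot_seq (cand_perm tau A) = [seq tau @: X | X : {set 'I_m} <- ballot_seq A].
Proof.
rewrite /ballot_seq -map_comp /=; apply/eq_in_map => i iA /=.
have iB : i \in domf (cand_perm tau A) by [].
have iA' : i \in domf A by [].
by rewrite /ballot (in_fnd iB) (@in_fnd _ _ A _ iA') /= ffunE; congr (imset _ (mem (A _))); apply: val_inj.
Qed.

Definition seq_profile (o : nat) l : ballots m :=
  [fmap x : [fset i in iota o (size l)]%fset => nth set0 l (fsval x - o)].
Arguments seq_profile : simpl never.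

Lemma domf_seq_profile o l : domf (seq_profile o l) =i iota o (size l).
Proof. by move=> i; rewrite /seq_profile /= in_fset. Qed.

Lemma ballot_seq_profile o l i : (i < size l)%N -> ballot (seq_profile o l) (o + i) = nth set0 l i.
Proof.
move=> il; have h : o + i \in domf (seq_profile o l) by rewrite domf_seq_profile mem_iota; lia.
by rewrite /ballot (in_fnd h) /= ffunE /= addKn.
Qed.

Lemma ballot_seq_seq_profile o l : perm_eq (ballot_seq (seq_profile o l)) l.
Proof.
apply: perm_trans (perm_ballot_seq (iota_uniq o (size l)) _) _.
  by move=> i; rewrite domf_seq_profile.
rewrite (_ : map _ _ = l) //; apply: (@eq_from_nth _ set0) => [|i].
  by rewrite size_map size_iota.
rewrite size_map size_iota => il.
by rewrite (nth_map 0) ?size_iota // nth_iota // ballot_seq_profile.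
Qed.

Lemma valid_perm l l' : perm_eq l l' -> valid l = valid l'.
Proof.
move=> p; rewrite /valid (perm_mem p); congr (_ && _).
by rewrite -!size_eq0 (perm_size p).
Qed.

Lemma valid_cat l l' : valid l -> valid l' -> valid (l ++ l').
Proof.
rewrite /valid mem_cat => /andP[l0 /negbTE ->] /andP[_ /negbTE ->].
by case: (l) l0.
Qed.

Lemma valid_copies n l : (0 < n)%N -> valid l -> valid (flatten (nseq n l)).
Proof.
case: n => // n _ vl; elim: n => [|n IH]; first by rewrite /= cats0.
exact: valid_cat.
Qed.

Lemma valid_map (tau : {perm 'I_m}) l :
  valid [seq tau @: X | X : {set 'I_m} <- l] = valid l.
Proof.
rewrite /valid -size_eq0 size_map size_eq0; congr (_ && ~~ _).
apply/mapP/idP => [[X Xl /esym/eqP]|l0]; first by rewrite imset_eq0 => /eqP <-.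
by exists set0; rewrite ?imset0.
Qed.

Lemma seq_profile_valid o l : is_profile (seq_profile o l) = valid l.
Proof. by rewrite is_profile_valid; apply/valid_perm/ballot_seq_seq_profile. Qed.

Lemma seq_profile_disjoint o l o' l' : (o + size l <= o')%N ->
  disjoint_prof (seq_profile o l) (seq_profile o' l').
Proof.
move=> h; apply/eqP/fsetP => i; rewrite inE in_fset0 !domf_seq_profile !mem_iota; lia.
Qed.

Lemma seq_profile_copies n o l : copies n (seq_profile 0 l) (seq_profile o (flatten (nseq n l))).
Proof.
have sz n' : size (flatten (nseq n' l)) = (n' * size l)%N.
  by elim: n' => //= n' IH; rewrite size_cat IH mulSn.
have nthE n' j i : (j < n')%N -> (i < size l)%N ->
    nth set0 (flatten (nseq n' l)) (j * size l + i) = nth set0 l i.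
  elim: n' j => // n' IH [|j] jn il /=; rewrite nth_cat; first by rewrite mul0n il.
  by rewrite ifF ?mulSn -?addnA ?addKn ?IH //; lia.
have lt j i : (j < n)%N -> (i < size l)%N -> (j * size l + i < n * size l)%N.
  by move=> jn il; rewrite (leq_trans _ (leq_mul jn (leqnn _))) // mulSn; lia.
(* Copies occupy consecutive blocks of length [size l]; quotient and remainder recover the copy and
   the voter. *)
exists (fun j i => o + (j * size l + i)); split; [|split].
- move=> j1 j2 i1 i2 _ _; rewrite !domf_seq_profile !mem_iota !add0n /= => h1 h2 /addnI e.
  have : (j1 * size l + i1) %/ size l = (j2 * size l + i2) %/ size l by rewrite e.
  have l0 : (0 < size l)%N by lia.
  rewrite !divnMDl // (divn_small h1) (divn_small h2) !addn0 => ej.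
  by split => //; move: e; rewrite ej => /addnI.
- move=> v; rewrite domf_seq_profile mem_iota sz; split => [/andP[ov vl]|].
    exists ((v - o) %/ size l), ((v - o) %% size l).
    have l0 : (0 < size l)%N by case: (size l) vl => [|//]; rewrite muln0; lia.
    rewrite domf_seq_profile mem_iota add0n ltn_mod l0 -divn_eq subnKC //; split => //.
    rewrite ltn_divLR //; lia.
  move=> [j [i [jn []]]]; rewrite domf_seq_profile mem_iota => /= il ->.
  by rewrite leq_addr /= ltn_add2l lt.
- move=> j i jn; rewrite domf_seq_profile mem_iota add0n /= => il.
  have hs : (j * size l + i < size (flatten (nseq n l)))%N by rewrite sz lt.
  rewrite !fnd_ballot ?domf_seq_profile ?mem_iota ?leq_addr /= ?ltn_add2l //.
  congr Some; rewrite -[RHS]/(ballot (seq_profile 0 l) (0 + i)).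
  by rewrite !ballot_seq_profile // nthE.
Qed.

End Ballots.

(** * The axioms for rules on lists of ballots *)

Section ListRule.
Variables (m k : nat) (f : ballots m -> {set {set 'I_m}}).
Implicit Types (A B : ballots m) (l : seq {set 'I_m}).

(** Anonymity needs a bijection of all of [nat]. With [o] above every voter the new block of voters
    avoids [domf A], and an involution exchanging the two blocks renumbers the electorate. *)
Lemma anonymous_seq_profile o A l : anonymous f -> is_profile A ->
  (forall i, i \in domf A -> (i < o)%N) -> perm_eq l (ballot_seq A) ->
  f A = f (seq_profile o l).
Proof.
move=> fan pA Ao /(perm_iotaP set0)[Is pIs el].
rewrite size_map in pIs.
(* The voters of [A], ordered so that their ballots spell out [l]. *)
pose s := map (nth 0 (domf A)) Is.
have ps : perm_eq s (domf A).
  have e : [seq nth 0 (domf A) i | i <- iota 0 (size (domf A))] = domf A.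
    by rewrite -/(mkseq _ _) mkseq_nth.
  by rewrite -[X in perm_eq _ X]e; apply: perm_map.
have us : uniq s by rewrite (perm_uniq ps) fset_uniq.
have ms i : (i \in s) = (i \in domf A) by rewrite (perm_mem ps).
have ls : l = map (ballot A) s.
  rewrite el /s -map_comp; apply/eq_in_map => i.
  by rewrite (perm_mem pIs) mem_iota => ia; rewrite /= (nth_map 0).
have sl : size l = size s by rewrite ls size_map.
pose pi x := if (x < o)%N then (if x \in s then o + index x s else x)
             else if (x < o + size s)%N then nth 0 s (x - o) else x.
have pis i : (i < size s)%N -> pi (nth 0 s i) = o + i.
  move=> il; have h : nth 0 s i \in s by rewrite mem_nth.
  by rewrite /pi Ao -?ms // h index_uniq.
have piK : involutive pi.
  move=> x; rewrite [pi x]/pi; case: ltnP => xo.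
    case: (boolP (x \in s)) => xs; last by rewrite /pi xo (negbTE xs).
    rewrite /pi ifF; last lia.
    by rewrite ltn_add2l index_mem xs addKn nth_index.
  case: ltnP => xs; last by rewrite /pi !ifF //; lia.
  by rewrite pis; lia.
apply/esym/(fan pi) => //; first exact: inv_bij.
split.
  apply/fsetP => x; rewrite domf_seq_profile mem_iota; apply/idP/imfsetP => [h|[y /= yA ->]].
    have {}h : (o <= (x : nat))%N /\ ((x : nat) - o < size s)%N by rewrite -sl; lia.
    exists (nth 0 s (x - o)); last by rewrite pis ?subnKC; case: h.
    by rewrite -[_ \in _]/(_ \in domf A) -ms mem_nth //; case: h.
  have hy : (index y s < size s)%N by rewrite index_mem ms.
  by rewrite -(@nth_index _ 0 y s) ?ms // pis // sl leq_addr ltn_add2l.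
move=> i iA; have h : (index i s < size s)%N by rewrite index_mem ms.
have -> : pi i = o + index i s by rewrite -[in LHS](@nth_index _ 0 i s) ?ms // pis.
rewrite !fnd_ballot ?domf_seq_profile ?mem_iota ?sl //; last lia.
by rewrite ballot_seq_profile ?sl // ls (nth_map 0) // nth_index ?ms.
Qed.

(** Both profiles are moved to the same [seq_profile], at an offset above both electorates. *)
Lemma anonymous_perm A B : anonymous f -> is_profile A ->
  perm_eq (ballot_seq A) (ballot_seq B) -> f A = f B.
Proof.
move=> fan pA pAB; have pB : is_profile B by rewrite is_profile_valid -(valid_perm pAB) -is_profile_valid.
pose o := (\max_(i <- (domf A : seq nat) ++ domf B) i).+1.
have ho i : i \in (domf A : seq nat) ++ domf B -> (i < o)%N.
  by move=> h; rewrite ltnS (@leq_bigmax_seq _ _ xpredT id).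
rewrite (anonymous_seq_profile (o := o) fan pA _ (perm_refl _)); last first.
  by move=> i iA; rewrite ho // mem_cat iA.
rewrite (anonymous_seq_profile (o := o) fan pB _ pAB) // => i iB.
by rewrite ho // mem_cat [X in _ || X]iB orbT.
Qed.

Hypotheses (fABC : is_ABC_rule k f) (fan : anonymous f) (fneu : neutral f)
  (fcons : consistent f) (fcont : continuous f) (find : indep_losers f).

Definition list_rule l := f (seq_profile 0 l).

Lemma list_ruleE A : is_profile A -> f A = list_rule (ballot_seq A).
Proof.
by move=> pA; apply: anonymous_perm => //; rewrite perm_sym ballot_seq_seq_profile.
Qed.

Lemma list_rule_perm l l' : valid l -> perm_eq l l' -> list_rule l = list_rule l'.
Proof.
move=> vl p; apply: anonymous_perm; rewrite ?seq_profile_valid //.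
apply: perm_trans (ballot_seq_seq_profile 0 l) _; apply: perm_trans p _.
by rewrite perm_sym ballot_seq_seq_profile.
Qed.

Lemma list_rule_neq0 l : valid l -> list_rule l != set0.
Proof. by move=> vl; have [] := @fABC (seq_profile 0 l); rewrite ?seq_profile_valid. Qed.

Lemma list_rule_card l W : valid l -> W \in list_rule l -> #|W| = k.
Proof. by move=> vl; have [_ h] := @fABC (seq_profile 0 l) ltac:(by rewrite seq_profile_valid) => /h. Qed.

Lemma list_rule_at o l : valid l -> f (seq_profile o l) = list_rule l.
Proof.
move=> vl; rewrite list_ruleE ?seq_profile_valid //; apply: list_rule_perm.
  by rewrite (valid_perm (ballot_seq_seq_profile o l)).
exact: ballot_seq_seq_profile.
Qed.

Lemma list_rule_catf o o' l l' : valid l -> valid l' ->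
  disjoint_prof (seq_profile o l) (seq_profile o' l') ->
  f (catf (seq_profile o l) (seq_profile o' l')) = list_rule (l ++ l').
Proof.
move=> vl vl' d.
have p : perm_eq (ballot_seq (catf (seq_profile o l) (seq_profile o' l'))) (l ++ l').
  by apply: perm_trans (ballot_seq_cat d) (perm_cat _ _); apply: ballot_seq_seq_profile.
have vc := valid_cat vl vl'.
rewrite list_ruleE ?is_profile_valid ?(valid_perm p) //.
by apply: list_rule_perm => //; rewrite ?(valid_perm p).
Qed.

Lemma list_rule_cat l l' : valid l -> valid l' ->
  list_rule l :&: list_rule l' != set0 ->
  list_rule (l ++ l') = list_rule l :&: list_rule l'.
Proof.
move=> vl vl' h; have d := @seq_profile_disjoint m 0 l (size l) l' (leqnn _).
rewrite -(list_rule_catf vl vl' d) fcons ?seq_profile_valid //.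
  by rewrite !list_rule_at.
by rewrite !list_rule_at.
Qed.

Lemma list_rule_cont l l' : valid l -> valid l' -> exists n, (0 < n)%N /\
  list_rule (flatten (nseq n l) ++ l') \subset list_rule l.
Proof.
move=> vl vl'.
have [n [n0 h]] := @fcont (seq_profile 0 l) (seq_profile 0 l') ltac:(by rewrite seq_profile_valid) ltac:(by rewrite seq_profile_valid).
exists n; split=> //.
have d : disjoint_prof (seq_profile (size l') (flatten (nseq n l))) (seq_profile 0 l').
  by rewrite /disjoint_prof fsetIC; apply: seq_profile_disjoint.
have vn := valid_copies n0 vl.
rewrite -(list_rule_catf vn vl' d) -(list_rule_at 0 vl).
by apply: h => //; apply: seq_profile_copies.
Qed.

Lemma list_rule_neu (tau : {perm 'I_m}) l : valid l ->
  list_rule [seq tau @: X | X : {set 'I_m} <- l] =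
  [set tau @: W | W : {set 'I_m} in list_rule l].
Proof.
move=> vl; have pA : is_profile (seq_profile 0 l) by rewrite seq_profile_valid.
rewrite -[RHS](fneu tau pA).
have p : perm_eq (ballot_seq (cand_perm tau (seq_profile 0 l))) [seq tau @: X | X : {set 'I_m} <- l].
  by rewrite ballot_seq_cand_perm; apply/perm_map/ballot_seq_seq_profile.
have vt : valid [seq tau @: X | X : {set 'I_m} <- l] by rewrite valid_map.
rewrite list_ruleE ?is_profile_valid ?(valid_perm p) //.
by apply/esym/list_rule_perm => //; rewrite ?(valid_perm p).
Qed.

Lemma list_rule_ind (W X X' : {set 'I_m}) l : valid (X :: l) -> valid (X' :: l) ->
  X' \subset X -> W :&: X' = W :&: X ->
  W \in list_rule (X :: l) -> W \in list_rule (X' :: l).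
Proof.
move=> v v' sX eX; apply: find; rewrite ?seq_profile_valid //.
move=> i; rewrite domf_seq_profile mem_iota add0n => /andP[_ il] Y Y'.
rewrite !fnd_ballot ?domf_seq_profile ?mem_iota // -[i]add0n !ballot_seq_profile //.
by case: i il => [|i] il [<-] [<-] /=.
Qed.

End ListRule.

(** * Permutations with prescribed images *)

(** Completing each sequence to an enumeration of [T] and matching positions gives the bijection.
    Sequences allow images of points and of sets to be prescribed together. *)
Lemma perm_of_uniq_seqs (T : finType) (s1 s2 : seq T) :
  uniq s1 -> uniq s2 -> size s1 = size s2 ->
  exists tau : {perm T}, map tau s1 = s2.
Proof.
move=> u1 u2 sz.
pose c s := s ++ [seq x <- enum T | x \notin s].
have cu s : uniq s -> uniq (c s).
  move=> us; rewrite cat_uniq us filter_uniq ?enum_uniq // andbT /=.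
  by apply/hasPn => x; rewrite mem_filter => /andP[].
have ca s x : x \in c s.
  by rewrite mem_cat mem_filter mem_enum andbT orbN.
have cs s : uniq s -> size (c s) = #|T|.
  move=> us; rewrite cardE; apply/perm_size/uniq_perm => [||x]; rewrite ?cu ?enum_uniq //.
  by rewrite ca mem_enum.
pose h x := nth x (c s2) (index x (c s1)).
have hlt x : (index x (c s1) < size (c s2))%N by rewrite cs // -(cs s1) // index_mem ca.
have hinj : injective h.
  move=> x y; rewrite /h (set_nth_default y) // => /eqP.
  rewrite nth_uniq ?cu // => /eqP e.
  by rewrite -(nth_index x (ca s1 x)) e nth_index.
exists (perm hinj); case: s1 u1 sz @h hlt hinj => [|x0 s1']; first by case: (s2).
set s1 := x0 :: s1' => u1 sz h hlt hinj.
apply: (@eq_from_nth _ x0) => [|i]; rewrite size_map // => il.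
rewrite (nth_map x0) // permE /h /c.
have xs : nth x0 s1 i \in s1 by rewrite mem_nth.
rewrite index_cat xs index_uniq // nth_cat -sz il.
by apply: set_nth_default; rewrite -sz.
Qed.

Lemma imset_of_map (T : finType) (tau : {perm T}) (A B : {set T}) (s : seq T) :
  s =i A -> map tau s =i B -> tau @: A = B.
Proof.
move=> sA sB; apply/setP => x; rewrite -sB.
apply/imsetP/mapP => -[y yA ->]; exists y => //; by rewrite ?sA // -sA.
Qed.

Lemma imset_transitive (T : finType) (A B : {set T}) : #|A| = #|B| ->
  exists tau : {perm T}, tau @: A = B.
Proof.
rewrite !cardE => e.
have [tau h] := perm_of_uniq_seqs (enum_uniq (mem A)) (enum_uniq (mem B)) e.
exists tau; apply: (@imset_of_map _ _ _ _ (enum A)) => x; rewrite ?h mem_enum //.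
Qed.

Lemma imsetKp (T : finType) (tau : {perm T}) (X : {set T}) :
  (tau^-1)%g @: (tau @: X) = X.
Proof. by rewrite -imset_comp (eq_imset (g := id)) ?imset_id // => x /=; rewrite permK. Qed.

Lemma imsetKVp (T : finType) (tau : {perm T}) (X : {set T}) :
  tau @: ((tau^-1)%g @: X) = X.
Proof. by rewrite -imset_comp (eq_imset (g := id)) ?imset_id // => x /=; rewrite permKV. Qed.

Lemma imset_perm_inj (T : finType) (tau : {perm T}) :
  injective (fun X : {set T} => tau @: X).
Proof. by move=> X Y /(congr1 (fun Z : {set T} => (tau^-1)%g @: Z)) /=; rewrite !imsetKp. Qed.

(** * Signed ballot counts *)

Definition committees m k : {set {set 'I_m}} := [set W : {set 'I_m} | #|W| == k].
(* Signed ballot counts; the value at the empty set is junk, since no ballot is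
   empty. *)
Definition weight m := {ffun {set 'I_m} -> int}.
HB.instance Definition _ m := GRing.Zmodule.on (weight m).
Definition one_ballot m (X : {set 'I_m}) : weight m := [ffun Y => (Y == X)%:Z%R].
Definition wact m (tau : {perm 'I_m}) (v : weight m) : weight m :=
  [ffun X : {set 'I_m} => v ((tau^-1)%g @: X)].

Section WeightTheory.
Local Open Scope ring_scope.
Variable m : nat.
Implicit Types (v w : weight m) (X : {set 'I_m}) (tau : {perm 'I_m}).

Lemma weightD v w X : (v + w) X = v X + w X. Proof. by rewrite ffunE. Qed.
Lemma weightN v X : (- v) X = - v X. Proof. by rewrite ffunE. Qed.
Lemma weight0 X : (0 : weight m) X = 0. Proof. by rewrite ffunE. Qed.
Lemma weightMn v n X : (v *+ n) X = v X *+ n.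
Proof. by elim: n => [|n IH]; rewrite ?weight0 // !mulrS weightD IH. Qed.
Lemma weightMz v (z : int) X : (v *~ z) X = v X *~ z.
Proof. by case: z => n; rewrite ?NegzE ?mulrNz ?weightN -!pmulrn weightMn. Qed.
Lemma weight_sum (I : Type) (r : seq I) (P : pred I) (E : I -> weight m) X :
  (\sum_(i <- r | P i) E i) X = \sum_(i <- r | P i) E i X.
Proof. by elim/big_rec2: _ => [|i y x _ <-]; rewrite ?weight0 ?weightD. Qed.
Lemma weight_cst (z : int) X : ([ffun=> z] : weight m) X = z.
Proof. by rewrite ffunE. Qed.
Lemma one_ballotE X Y : one_ballot X Y = (Y == X)%:Z. Proof. by rewrite ffunE. Qed.

(** Adding this constant makes every count positive, so that the signed count comes from an actual
    profile. *)
Definition shift v : int := \sum_X `|v X| + 1.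

Lemma shiftP v X : 0 < v X + shift v.
Proof.
have : `|v X| <= \sum_X `|v X| by rewrite (bigD1 X) //= lerDl sumr_ge0.
rewrite /shift; lia.
Qed.

End WeightTheory.

(** The axioms carried over to signed counts. In [wr_losers] the trade of [X] for [X'] is itself a
    count at which [W] wins, so [wr_add] can combine it with any other. *)
Record weight_rule m k (F : weight m -> {set {set 'I_m}}) : Prop := WeightRule {
  wr_neq0 : forall v, F v != set0;
  wr_card : forall v W, W \in F v -> #|W| = k;
  wr_const : forall v (n : int), F (v + [ffun=> n])%R = F v;
  wr_neutral : forall (tau : {perm 'I_m}) v (W : {set 'I_m}),
    (tau @: W \in F (wact tau v)) = (W \in F v);
  wr_add : forall v w W, W \in F v -> W \in F w -> F (v + w)%R = F v :&: F w;
  wr_cont : forall v w, exists n, (0 < n)%N /\ F (v *+ n + w)%R \subset F v;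
  wr_losers : forall W X X' : {set 'I_m}, #|W| = k -> X' != set0 -> X' \subset X ->
    W :&: X' = W :&: X -> W \in F (one_ballot X' - one_ballot X)%R
}.

(** * Extension of a rule from profiles to signed counts *)

Section Extension.
Variables (m k : nat) (g : seq {set 'I_m} -> {set {set 'I_m}}).
Hypothesis m_gt0 : (0 < m)%N.
Hypothesis g_neq0 : forall l, valid l -> g l != set0.
Hypothesis g_card : forall l W, valid l -> W \in g l -> #|W| = k.
Hypothesis g_perm : forall l l', valid l -> perm_eq l l' -> g l = g l'.
Hypothesis g_cat : forall l l', valid l -> valid l' ->
  g l :&: g l' != set0 -> g (l ++ l') = g l :&: g l'.
Hypothesis g_cont : forall l l', valid l -> valid l' -> exists n, (0 < n)%N /\
  g (flatten (nseq n l) ++ l') \subset g l.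
Hypothesis g_neu : forall (tau : {perm 'I_m}) l, valid l ->
  g [seq tau @: X | X : {set 'I_m} <- l] = [set tau @: W | W : {set 'I_m} in g l].
Hypothesis g_ind : forall (W X X' : {set 'I_m}) l, valid (X :: l) -> valid (X' :: l) ->
  X' \subset X -> W :&: X' = W :&: X -> W \in g (X :: l) -> W \in g (X' :: l).

Local Open Scope ring_scope.
Implicit Types (v w : weight m) (l : seq {set 'I_m}).

(** Counts agree up to a common surplus [n]; the empty set is exempt because its count is junk. *)
Definition represents l v (n : int) :=
  valid l /\ forall X, X != set0 -> (count_mem X l)%:Z = v X + n.

Lemma represents_perm l l' v n : represents l v n -> represents l' v n -> perm_eq l l'.
Proof.
move=> [/andP[_ l0] h] [/andP[_ l0'] h']; apply/allP => X _ /=.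
have [->|X0] := eqVneq X set0; first by rewrite !(count_memPn _).
by apply/eqP; move: (h X X0); rewrite -h' // => -[].
Qed.

Lemma represents_cat l l' v v' n n' : represents l v n -> represents l' v' n' ->
  represents (l ++ l') (v + v') (n + n').
Proof.
move=> [vl h] [vl' h']; split=> [|X X0]; first exact: valid_cat.
by rewrite count_cat PoszD h // h' // weightD addrACA.
Qed.

Definition weight_seq v : seq {set 'I_m} :=
  flatten [seq nseq `|v X|%N X | X <- enum {set 'I_m} & X != set0].

Lemma count_weight_seq v X : X != set0 -> count_mem X (weight_seq v) = `|v X|%N.
Proof.
move=> X0; rewrite /weight_seq count_flatten sumnE !big_map big_filter big_enum_cond.
rewrite (bigD1 X) //= count_nseq /= eqxx mul1n big1 ?addn0 // => Y /andP[_ YX].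
by rewrite count_nseq /= (negbTE YX).
Qed.

Lemma weight_seq_represents v n : (forall X, 0 < v X + n) ->
  represents (weight_seq (v + [ffun=> n])) v n.
Proof.
move=> h; have c X : X != set0 -> (count_mem X (weight_seq (v + [ffun=> n])))%:Z = v X + n.
  by move=> X0; rewrite count_weight_seq // weightD weight_cst gez0_abs // ltW.
split=> //; apply/andP; split.
  pose X : {set 'I_m} := [set: 'I_m].
  have X0 : X != set0 by apply/set0Pn; exists (Ordinal m_gt0); rewrite inE.
  by apply: contraTneq (h X) => e; rewrite -c // e.
apply/negP => /flattenP[l /mapP[X]]; rewrite mem_filter => /andP[X0 _] ->.
by rewrite mem_nseq => /andP[_ /eqP e]; rewrite e eqxx in X0.
Qed.

(** Such a list is invariant, up to order, under all candidate permutations. By neutrality so is its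
    set of winners, and the sets of size [k] form a single orbit. *)
Lemma g_uniform l n : represents l 0 n -> g l = committees m k.
Proof.
move=> rl; have vl := rl.1; have [W0 W0l] := set0Pn _ (g_neq0 vl).
apply/setP => W; rewrite inE; apply/idP/eqP => [/(g_card vl)//|Wk].
have [|tau <-] := @imset_transitive _ W0 W; first by rewrite Wk (g_card vl).
have -> : g l = g [seq tau @: X | X : {set 'I_m} <- l].
  apply: g_perm => //; apply: (represents_perm rl); split.
    by rewrite valid_map.
  move=> X X0; rewrite count_map.
  have -> : count (preim (fun X : {set 'I_m} => tau @: X) (pred1 X)) l =
            count_mem ((tau^-1)%g @: X) l.
    apply: eq_count => Y /=; apply/eqP/eqP => [<-|->]; first by rewrite imsetKp.
    by rewrite imsetKVp.
  rewrite rl.2 ?ffunE // imset_eq0 //.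
by rewrite g_neu //; apply: imset_f.
Qed.

Definition extend v := g (weight_seq (v + [ffun=> shift v])).

(** Uniform profiles elect all committees, so by consistency they can be added freely. Adding
    suitable ones to two lists that represent [v] equalises the surpluses and makes the lists
    permutations of each other. *)
Lemma extendE l v n : represents l v n -> extend v = g l.
Proof.
move=> rl; have rv := weight_seq_represents (shiftP v).
have uni (l' : seq _) w n' (N : int) : represents l' w n' -> 0 < N ->
    g (l' ++ weight_seq (0 + [ffun=> N])) = g l'.
  move=> rl' N0; have r0 : represents (weight_seq (0 + [ffun=> N])) 0 N.
    by apply: weight_seq_represents => X; rewrite weight0 add0r.
  have e : g l' :&: g (weight_seq (0 + [ffun=> N])) = g l'.
    rewrite (g_uniform r0); apply/setIidPl/fintype.subsetP => W Wl.
    by rewrite inE (g_card rl'.1 Wl).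
  have v1 := rl'.1; have v2 := r0.1.
  by rewrite g_cat ?e ?g_neq0.
(* Large enough for both multiplicities, [M] and [M + shift v - n], to be positive. *)
pose M : int := `|shift v| + `|n| + 1.
have M0 : 0 < M + shift v - n by rewrite /M; move: (shift v) => z; lia.
have M1 : 0 < M by rewrite /M; move: (shift v) => z; lia.
rewrite /extend -(uni _ _ _ M rv) // -(uni _ _ _ (M + shift v - n) rl) //.
have r0 (n0 : int) : 0 < n0 -> represents (weight_seq (0 + [ffun=> n0])) 0 n0.
  by move=> n00; apply: weight_seq_represents => X; rewrite weight0 add0r.
apply: g_perm; first by apply: valid_cat; [exact: rv.1 | exact: (r0 _ M1).1].
have := represents_cat rl (r0 _ M0).
have -> : n + (M + shift v - n) = shift v + M by rewrite addrC subrK addrC.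
exact/represents_perm/(represents_cat rv (r0 _ M1)).
Qed.

Lemma extend_represents v : exists l n, represents l v n.
Proof. by eexists; exists (shift v); apply: weight_seq_represents; apply: shiftP. Qed.

Lemma extend_add v w W : W \in extend v -> W \in extend w ->
  extend (v + w) = extend v :&: extend w.
Proof.
have [l [n r]] := extend_represents v; have [l' [n' r']] := extend_represents w.
rewrite (extendE (represents_cat r r')) (extendE r) (extendE r') => Wv Ww.
have v1 := r.1; have v2 := r'.1.
by rewrite g_cat //; apply/set0Pn; exists W; rewrite inE Wv.
Qed.

Lemma extend_neutral (tau : {perm 'I_m}) v (W : {set 'I_m}) :
  (tau @: W \in extend (wact tau v)) = (W \in extend v).
Proof.
have [l [n r]] := extend_represents v; have vl := r.1.
have r' : represents [seq tau @: X | X : {set 'I_m} <- l] (wact tau v) n.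
  split.
    by rewrite valid_map.
  move=> X X0; rewrite count_map ffunE -r.2 ?imset_eq0 //; congr Posz.
  apply: eq_count => Y /=; apply/eqP/eqP => [<-|->]; first by rewrite imsetKp.
  by rewrite imsetKVp.
by rewrite (extendE r') (extendE r) g_neu // mem_imset //; apply: imset_perm_inj.
Qed.

Lemma extend_cont v w : exists n, (0 < n)%N /\ extend (v *+ n + w) \subset extend v.
Proof.
have [l [a r]] := extend_represents v; have [l' [b r']] := extend_represents w.
have [n [n0 h]] := g_cont r.1 r'.1; exists n; split=> //.
suff rn : represents (flatten (nseq n l)) (v *+ n) (a *+ n).
  by rewrite (extendE (represents_cat rn r')) (extendE r).
elim: n n0 {h} => // -[|n] IH _; first by rewrite /= cats0 !mulr1n.
by rewrite mulrS [a *+ _]mulrS; apply: represents_cat => //; apply: IH.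
Qed.

(** In the profile with every ballot once, where [W] wins, one ballot [X] is replaced by [X']; the
    outcome represents the difference with surplus 1. *)
Lemma extend_losers (W X X' : {set 'I_m}) : #|W| = k -> X' != set0 -> X' \subset X ->
  W :&: X' = W :&: X -> W \in extend (one_ballot X' - one_ballot X).
Proof.
move=> Wk X0' sX eX.
have X0 : X != set0 by apply: contraNneq X0' => X0; rewrite X0 subset0 in sX.
have r : represents (weight_seq (0 + [ffun=> 1])) 0 1.
  by apply: weight_seq_represents => Y; rewrite weight0 add0r.
set l := weight_seq _ in r; have [vl cl] := r.
have Xl : X \in l by rewrite -has_pred1 has_count; case: (count_mem X l) (cl X X0) => [|n]; rewrite weight0.
have p := perm_to_rem Xl.
have vr : valid (X :: rem X l) by rewrite -(valid_perm p).
have vr' : valid (X' :: rem X l).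
  move: vr; rewrite /valid !inE !negb_or /= => /andP[_ ->].
  by rewrite eq_sym X0'.
have r' : represents (X' :: rem X l) (one_ballot X' - one_ballot X) 1.
  split=> // Y Y0 /=; have := cl Y Y0.
  rewrite (seq.permP p) /= weightD weightN !one_ballotE weight0 (eq_sym Y X) (eq_sym Y X'); lia.
rewrite (extendE r'); apply: g_ind sX eX _ => //.
by rewrite -(g_perm vl p) (g_uniform r) inE Wk.
Qed.

Lemma extend_weight_rule : weight_rule k extend.
Proof.
split.
- by move=> v; have [l [n r]] := extend_represents v; rewrite (extendE r) g_neq0 // r.1.
- by move=> v W; have [l [n r]] := extend_represents v; rewrite (extendE r); apply: g_card; apply: r.1.
- move=> v n; have [l [n' r]] := extend_represents (v + [ffun=> n]).
  rewrite (extendE r); apply/esym/(@extendE l v (n + n')); split; first exact: r.1.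
  by move=> X X0; rewrite r.2 // weightD weight_cst addrA.
- exact: extend_neutral.
- exact: extend_add.
- exact: extend_cont.
- exact: extend_losers.
Qed.

End Extension.

(** * Positive functionals on integer cones *)

Section PositiveFunctional.
Local Open Scope ring_scope.
Variable R : realType.

(* One step of the M. Riesz extension theorem: [L] is the graph of a
   [K]-positive functional on a subgroup, extended to one more generator [e]. *)
Lemma positive_extension (G : zmodType) (K : G -> Prop) (L : G -> R -> Prop) (e : G) :
  (forall x y, K x -> K y -> K (x + y)) ->
  L 0 0 -> (forall x y r t, L x r -> L y t -> L (x - y) (r - t)) ->
  (forall x r, L x r -> K x -> 0 <= r) ->
  (exists y t, L y t /\ K (y - e)) -> (exists y t, L y t /\ K (y + e)) ->
  exists c, forall x r (n : int), L x r -> K (x + e *~ n) -> 0 <= r + c *~ n.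
Proof.
move=> KD L0 LB Lpos [y1 [t1 [Ly1 Ky1]]] [y2 [t2 [Ly2 Ky2]]].
have LD x y r t : L x r -> L y t -> L (x + y) (r + t).
  move=> Lx Ly; have := LB _ _ _ _ Lx (LB _ _ _ _ L0 Ly).
  by rewrite !sub0r !opprK.
have LM x r n : L x r -> L (x *+ n) (r *+ n).
  by move=> Lx; elim: n => [|n IH]; rewrite ?mulr0n // !mulrS; apply: LD.
have KM x n : K x -> K (x *+ n.+1).
  by move=> Kx; elim: n => [|n IH]; rewrite ?mulr1n // mulrS; apply: KD.
(* [S] collects the upper bounds that positivity imposes on the value at [e]; [Slb] treats the lower
   bounds. *)
pose S : classical_sets.set R := fun q =>
  exists x r (n : nat), [/\ L x r, K (x - e *+ n.+1) & q = r / n.+1%:R].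
have Sne : classical_sets.nonempty S.
  by exists t1; exists y1, t1, 0%N; rewrite divr1 mulr1n.
have Slb y t (p : nat) : L y t -> K (y + e *+ p.+1) ->
    classical_sets.lbound S (- t / p.+1%:R).
  move=> Ly Ky _ [x [r [n [Lx Kx ->]]]].
  (* Scaling the two members of [K] by [p.+1] and [n.+1] cancels [e], so [Lpos] compares the two
     bounds. *)
  have h : 0 <= r *+ p.+1 + t *+ n.+1.
    apply: (Lpos (x *+ p.+1 + y *+ n.+1)); first by apply: LD; apply: LM.
    have := KD _ _ (KM _ p Kx) (KM _ n Ky).
    by rewrite mulrnBl mulrnDl -!mulrnA [(p.+1 * _)%N]mulnC addrACA addNr addr0.
  rewrite ler_pdivrMr ?ltr0Sn // mulrAC ler_pdivlMr ?ltr0Sn //.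
  by rewrite mulNr !mulr_natr lerNl -subr_ge0 opprK addrC.
exists (inf S) => x r [[|p]|p] Lx.
- by rewrite /= !mulr0z !addr0; apply: Lpos.
- rewrite -!pmulrn => Kx; have := lb_le_inf Sne (Slb _ _ _ Lx Kx).
  by rewrite ler_pdivrMr ?ltr0Sn // mulr_natr lerNl -subr_ge0 opprK addrC.
- rewrite NegzE !mulrNz -!pmulrn => Kx.
  have hS : S (r / p.+1%:R) by exists x, r, p.
  have := ge_inf _ hS; rewrite ler_pdivlMr ?ltr0Sn // mulr_natr -subr_ge0; apply.
  exists (- t2 / 1%:R); apply: (Slb y2 t2 0%N) => //; by rewrite mulr1n.
Qed.

(** The value 1 on the all-ones vector [u] is compatible with positivity because [- u] is not in
    [K]; the functional is then extended along the unit vectors one at a time. *)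
Lemma positive_functional k (K : {ffun 'I_k -> int} -> Prop) :
  K 0 -> (forall x y, K x -> K y -> K (x + y)) ->
  (forall i, K [ffun j => (j == i)%:Z]) -> ~ K [ffun=> -1] ->
  exists delta : 'I_k -> R, [/\ forall i, 0 <= delta i, \sum_i delta i = 1 &
    forall x, K x -> 0 <= \sum_i delta i *~ x i].
Proof.
move=> K0 KD Ke Kn1.
pose u : {ffun 'I_k -> int} := [ffun=> 1].
have Ksum (P : pred 'I_k) : K (\sum_(i | P i) [ffun j => (j == i)%:Z]).
  by elim/big_rec: _ => // i x _ Kx; apply: KD.
have Ksub (P : pred 'I_k) : K [ffun j => (P j)%:Z].
  rewrite (_ : [ffun j => _] = \sum_(i | P i) [ffun j => (j == i)%:Z]) //.
  apply/ffunP => j; rewrite sum_ffunE !ffunE.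
  under eq_bigr do rewrite ffunE.
  rewrite big_mkcond (bigD1 j) //= eqxx big1 ?addr0; first by case: (P j).
  by move=> i ij; rewrite eq_sym (negbTE ij); case: ifP.
have Ku : K u by have := Ksub xpredT.
(* The functional is kept on pairs [(n, x)] standing for [u *~ n + x], with [x] supported on the
   first [t] coordinates. At [t = k] the vector [u] has two descriptions; positivity at 0 forces
   equal values, which gives the normalisation of [delta]. *)
pose ok t (delta : 'I_k -> R) := forall (n : int) (x : {ffun 'I_k -> int}),
  (forall i : 'I_k, (t <= i)%N -> x i = 0) -> K (u *~ n + x) ->
  0 <= n%:~R + \sum_i delta i *~ x i.
have step t : (t <= k)%N -> exists delta, ok t delta.
  elim: t => [_|t IH tk].
    exists (fun=> 0) => n x x0.
    have -> : x = 0 by apply/ffunP => i; rewrite x0 // ffunE.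
    rewrite addr0 big1 ?addr0 => [|i _]; last by rewrite mul0rz.
    case: n => [n|n]; first by rewrite ler0n.
    (* A negative multiple of [u] in [K], topped up by copies of [u], would put [- u] in [K]. *)
    rewrite NegzE mulrNz => Kn; case: Kn1.
    have Kun p : K (u *+ p) by elim: p => [|p IHp]; rewrite ?mulr0n // mulrS; apply: KD.
    have := KD _ _ Kn (Kun n); rewrite -pmulrn mulrS opprD subrK.
    by rewrite (_ : - u = [ffun=> -1]) //; apply/ffunP => i; rewrite !ffunE.
  have [delta dok] := IH (ltnW tk).
  pose i0 := Ordinal tk; pose e : {ffun 'I_k -> int} := [ffun j => (j == i0)%:Z].
  pose L (x : {ffun 'I_k -> int}) (r : R) := exists (n : int) (y : {ffun 'I_k -> int}),
    [/\ forall i : 'I_k, (t <= i)%N -> y i = 0, x = u *~ n + y &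
        r = n%:~R + \sum_i delta i *~ y i].
  have [|||||c hc] := @positive_extension _ K L e KD.
  - exists 0, 0; split; first by move=> i _; rewrite ffunE.
      by rewrite mulr0z addr0.
    by rewrite big1 ?addr0 // => i _; rewrite ffunE mulr0z.
  - move=> _ _ _ _ [n [y [y0 -> ->]]] [n' [y' [y0' -> ->]]].
    exists (n - n'), (y - y'); split.
    + by move=> i ti; rewrite !ffunE y0 // y0' // subrr.
    + by rewrite mulrzBr opprD addrACA.
    + rewrite mulrzBr opprD addrACA; congr (_ + _); rewrite -sumrB.
      by apply: eq_bigr => i _; rewrite !ffunE mulrzBr.
  - by move=> _ _ [n [y [y0 -> ->]]]; apply: dok.
  (* [u - e] is a sum of unit vectors and [e] is one of them, so [e] lies between 0 and [u] in the
     order of [K]. *)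
  - exists u, 1; split.
      exists 1, 0; split; first by move=> i _; rewrite ffunE.
        by rewrite mulr1z addr0.
      by rewrite big1 ?addr0 // => i _; rewrite ffunE mulr0z.
    rewrite (_ : u - e = [ffun j => (j != i0)%:Z]) //.
    by apply/ffunP => j; rewrite !ffunE; case: (j == i0).
  - exists 0, 0; split; last by rewrite add0r; apply: Ke.
    exists 0, 0; split; first by move=> i _; rewrite ffunE.
      by rewrite mulr0z addr0.
    by rewrite big1 ?addr0 // => i _; rewrite ffunE mulr0z.
  exists (fun i => if i == i0 then c else delta i) => n x x0 Kx.
  pose y : {ffun 'I_k -> int} := [ffun i => if i == i0 then 0 else x i].
  have xE : x = y + e *~ x i0.
    have eM i (z : int) : (e *~ z) i = e i *~ z.
      by case: z => p; rewrite ?NegzE ?mulrNz ?ffunE -!pmulrn ffunMnE ?ffunE.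
    apply/ffunP => i; rewrite ffunE eM !ffunE.
    by case: (eqVneq i i0) => [->|_]; rewrite ?add0r ?mul0rz ?addr0 //= intz.
  have Ly : L (u *~ n + y) (n%:~R + \sum_i delta i *~ y i).
    exists n, y; split => // i ti; rewrite ffunE; case: eqVneq => // ii0; apply: x0.
    by rewrite ltn_neqAle ti andbT; apply: contraNneq ii0 => e'; apply/eqP/val_inj.
  have := hc _ _ (x i0) Ly; rewrite -addrA -xE => /(_ Kx).
  congr (0 <= _); rewrite -addrA; congr (_ + _).
  rewrite (bigD1 i0) //= [RHS](bigD1 i0) //= ffunE eqxx mulr0z add0r addrC.
  by congr (_ + _); apply: eq_bigr => i ii0; rewrite ffunE (negbTE ii0).
have [delta dok] := step k (leqnn k).
have big0 (x : {ffun 'I_k -> int}) (i : 'I_k) : (k <= i)%N -> x i = 0.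
  by rewrite leqNgt ltn_ord.
exists delta; split.
- move=> i; have := dok 0 [ffun j => (j == i)%:Z] (big0 _).
  rewrite mulr0z !add0r => /(_ (Ke i)); rewrite (bigD1 i) //= ffunE eqxx mulr1z.
  rewrite big1 ?addr0 // => j ji; by rewrite ffunE (negbTE ji) mulr0z.
- apply/eqP; rewrite eq_le; apply/andP; split.
    have := dok 1 (- u) (big0 _); rewrite mulr1z subrr => /(_ K0).
    have -> : \sum_i delta i *~ (- u) i = - \sum_i delta i.
      by rewrite -sumrN; apply: eq_bigr => i _; rewrite !ffunE mulrNz mulr1z.
    by rewrite subr_ge0.
  have := dok (- 1) u (big0 _); rewrite mulrNz mulr1z addrC subrr => /(_ K0).
  have -> : \sum_i delta i *~ u i = \sum_i delta i.
    by apply: eq_bigr => i _; rewrite !ffunE mulr1z.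
  by rewrite mulrNz addrC subr_ge0.
- by move=> x Kx; have := dok 0 x (big0 _); rewrite mulr0z !add0r; apply.
Qed.

End PositiveFunctional.

(** * Subsets of prescribed size *)

Definition initial_subset (T : finType) (Z : {set T}) (l : nat) : {set T} :=
  [set x in take l (enum Z)].

Lemma initial_subset_sub (T : finType) (Z : {set T}) l : initial_subset Z l \subset Z.
Proof. by apply/fintype.subsetP => x; rewrite inE => /mem_take; rewrite mem_enum. Qed.

Lemma initial_subset_card (T : finType) (Z : {set T}) l :
  (l <= #|Z|)%N -> #|initial_subset Z l| = l.
Proof.
move=> lZ; rewrite cardsE (card_uniqP _) ?take_uniq ?enum_uniq // size_takel //.
by rewrite -cardE.
Qed.

(** * Candidate permutations acting on counts *)

Section Action.
Local Open Scope ring_scope.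
Variable m : nat.
Implicit Types (v w : weight m) (X : {set 'I_m}) (tau : {perm 'I_m}).

Lemma wactE tau v X : wact tau v (tau @: X) = v X.
Proof. by rewrite ffunE imsetKp. Qed.

Lemma wactD tau v w : wact tau (v + w) = wact tau v + wact tau w.
Proof. by apply/ffunP => X; rewrite weightD !ffunE. Qed.

Lemma wact0 tau : wact tau 0 = 0 :> weight m.
Proof. by apply/ffunP => X; rewrite !ffunE. Qed.

Lemma wactMn tau v n : wact tau (v *+ n) = wact tau v *+ n.
Proof. by elim: n => [|n IH]; rewrite ?wact0 // !mulrS wactD IH. Qed.

Lemma wactN tau v : wact tau (- v) = - wact tau v.
Proof. by apply/ffunP => X; rewrite weightN !ffunE. Qed.

Lemma wactMz tau v (z : int) : wact tau (v *~ z) = wact tau v *~ z.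
Proof. by case: z => n; rewrite ?NegzE ?mulrNz ?wactN -!pmulrn wactMn. Qed.

Lemma wact_sum tau (I : Type) (r : seq I) (P : pred I) (E : I -> weight m) :
  wact tau (\sum_(i <- r | P i) E i) = \sum_(i <- r | P i) wact tau (E i).
Proof. by elim/big_rec2: _ => [|i y x _ <-]; rewrite ?wact0 ?wactD. Qed.

Lemma wact_one tau X : wact tau (one_ballot X) = one_ballot (tau @: X).
Proof.
apply/ffunP => Y; rewrite !ffunE; congr (Posz (nat_of_bool _)).
by apply/eqP/eqP => [<-|->]; rewrite ?imsetKVp ?imsetKp.
Qed.

Lemma imset_permM tau rho X : (tau * rho)%g @: X = rho @: (tau @: X).
Proof. by rewrite -imset_comp; apply: eq_imset => x; rewrite permM. Qed.

Lemma imset_perm1 X : (1%g : {perm 'I_m}) @: X = X.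
Proof. by rewrite (eq_imset (g := id)) ?imset_id // => x; rewrite perm1. Qed.

Lemma wact1 v : wact 1%g v = v.
Proof. by apply/ffunP => X; rewrite ffunE invg1 imset_perm1. Qed.

Lemma wactK tau v : (tau * tau = 1)%g -> wact tau (wact tau v) = v.
Proof.
move=> tt; apply/ffunP => X; rewrite !ffunE -imset_permM -invMg tt invg1.
by rewrite imset_perm1.
Qed.

Lemma weight_basis v : v = \sum_X one_ballot X *~ v X.
Proof.
apply/ffunP => Y; rewrite weight_sum (bigD1 Y) //= weightMz one_ballotE eqxx big1.
  by rewrite addr0 intz.
by move=> X XY; rewrite weightMz one_ballotE eq_sym (negbTE XY) mul0rz.
Qed.

Lemma imset_tperm_fix (a b : 'I_m) X : (a \in X) = (b \in X) -> tperm a b @: X = X.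
Proof.
move=> ab; apply/setP => x; rewrite -[x in LHS](tpermK a b) mem_imset; last exact: perm_inj.
by case: tpermP => [->|->|] //; rewrite ab.
Qed.

End Action.

(** * Scores of signed counts *)

Section Score.
Local Open Scope ring_scope.
Variables (R : realType) (m : nat) (s : nat -> R).
Implicit Types (v w : weight m) (X W : {set 'I_m}) (tau : {perm 'I_m}).

(** The empty set contributes [s 0 *~ v set0] whatever [W] is, so its junk count never affects
    comparisons. *)
Definition score v W : R := \sum_(X : {set 'I_m}) s #|X :&: W| *~ v X.

Lemma scoreD v w W : score (v + w) W = score v W + score w W.
Proof. by rewrite -big_split; apply: eq_bigr => X _; rewrite weightD mulrzDr. Qed.

Lemma score0 W : score 0 W = 0.
Proof. by apply: big1 => X _; rewrite weight0 mulr0z. Qed.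

Lemma scoreN v W : score (- v) W = - score v W.
Proof. by rewrite -sumrN; apply: eq_bigr => X _; rewrite weightN mulrNz. Qed.

Lemma scoreMn v n W : score (v *+ n) W = score v W *+ n.
Proof. by elim: n => [|n IH]; rewrite ?mulr0n ?score0 // !mulrS scoreD IH. Qed.

Lemma score_sum (I : Type) (r : seq I) (P : pred I) (E : I -> weight m) W :
  score (\sum_(i <- r | P i) E i) W = \sum_(i <- r | P i) score (E i) W.
Proof. by elim/big_rec2: _ => [|i y x _ <-]; rewrite ?score0 ?scoreD. Qed.

Lemma score_one X W : score (one_ballot X) W = s #|X :&: W|.
Proof.
rewrite /score (bigD1 X) //= one_ballotE eqxx mulr1z big1 ?addr0 // => Y YX.
by rewrite one_ballotE (negbTE YX) mulr0z.
Qed.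

Lemma score_act tau v W : score (wact tau v) (tau @: W) = score v W.
Proof.
rewrite /score (reindex_inj (@imset_perm_inj _ tau)); apply: eq_bigr => X _.
by rewrite wactE -imsetI ?card_imset //; [exact: perm_inj | move=> x y _ _; exact: perm_inj].
Qed.

End Score.

(** * Swaps between adjacent committees *)

Section WeightRule.
Local Open Scope ring_scope.
Variables (m k : nat) (F : weight m -> {set {set 'I_m}}).
Hypothesis FR : weight_rule k F.
Implicit Types (v w : weight m) (W X : {set 'I_m}) (tau : {perm 'I_m}).

Lemma rule0 W : #|W| = k -> W \in F 0.
Proof.
move=> Wk; have [W0 W00] := set0Pn _ (wr_neq0 FR 0).
have [|tau <-] := @imset_transitive _ W0 W; first by rewrite Wk (wr_card FR W00).
by rewrite -(wact0 tau) (wr_neutral FR).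
Qed.

Lemma ruleD v w W : W \in F v -> W \in F w -> W \in F (v + w).
Proof. by move=> Wv Ww; rewrite (wr_add FR Wv Ww) inE Wv. Qed.

(** Consistency as cancellation: [W] shows that the two sets of winners meet, so winners of the sum
    win at each summand. *)
Lemma rule_subl v w W W' : W \in F v -> W \in F w -> W' \in F (v + w) -> W' \in F v.
Proof. by move=> Wv Ww; rewrite (wr_add FR Wv Ww) inE => /andP[]. Qed.

Lemma ruleMn v n W : W \in F v -> W \in F (v *+ n).
Proof.
move=> Wv; elim: n => [|n IH]; first exact/rule0/(wr_card FR Wv).
by rewrite mulrS ruleD.
Qed.

Lemma rule_sum (I : finType) (P : pred I) (E : I -> weight m) W : #|W| = k ->
  (forall i, P i -> W \in F (E i)) -> W \in F (\sum_(i | P i) E i).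
Proof.
move=> Wk h; elim/big_rec: _ => [|i x Pi Wx]; first exact: rule0.
by apply: ruleD => //; apply: h.
Qed.

Lemma rule_sum_sub (I : finType) (P : pred I) (E : I -> weight m) W W' i : P i ->
  (forall i, P i -> W \in F (E i)) -> W' \in F (\sum_(i | P i) E i) -> W' \in F (E i).
Proof.
move=> Pi h; rewrite (bigD1 i) //=; apply: (@rule_subl _ _ W); first exact: h.
by apply: rule_sum => [|j /andP[Pj _]]; rewrite ?(wr_card FR (h _ Pi)) // h.
Qed.

Section Swap.
Variables (Z : {set 'I_m}) (a b : 'I_m).
Hypotheses (aZ : a \notin Z) (bZ : b \notin Z) (ab : a != b) (Zk : #|Z|.+1 = k).

(* Only ballots containing exactly one of [a], [b] distinguish [a |: Z] from
   [b |: Z], and only through their intersection size with [Z]. *)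
Definition swap_diff v : {ffun 'I_k -> int} :=
  [ffun l : 'I_k => \sum_X v X * ((a \in X)%:Z - (b \in X)%:Z) * (#|X :&: Z| == l)%:Z].

Lemma swap_diffD v w : swap_diff (v + w) = swap_diff v + swap_diff w.
Proof.
apply/ffunP => l; rewrite !ffunE -big_split; apply: eq_bigr => X _ /=.
by rewrite weightD !mulrDl.
Qed.

Lemma card_capZ X : (#|X :&: Z| < k)%N.
Proof. by rewrite -Zk ltnS subset_leq_card // subsetIr. Qed.

(** Exchanging [a] and [b] in the ballots preserves [#|X :&: Z|] and matches the ballots counted
    positively with those counted negatively. *)
Lemma swap_diff_cst (n : int) : swap_diff [ffun=> n] = 0.
Proof.
apply/ffunP => l; rewrite !ffunE.
under eq_bigr do rewrite weight_cst mulrBr mulrBl.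
rewrite sumrB; apply/eqP; rewrite subr_eq0; apply/eqP.
rewrite (reindex_inj (@imset_perm_inj _ (tperm a b))) /=; apply: eq_bigr => X _.
congr (_ * Posz (nat_of_bool _) * Posz (nat_of_bool _)).
  have := @mem_imset _ _ (tperm a b) X b (@perm_inj _ _); by rewrite tpermR.
have ZZ : tperm a b @: Z = Z by apply: imset_tperm_fix; rewrite (negbTE aZ) (negbTE bZ).
rewrite -{1}ZZ -imsetI ?card_imset //; first exact: perm_inj.
by move=> x y _ _; apply: perm_inj.
Qed.

(** These permutations preserve [a |: Z] and [b |: Z], so summing a count over [H] keeps a winner
    among the two winning. *)
Let H : {set {perm 'I_m}} := [set tau : {perm 'I_m} | [&& tau a == a, tau b == b & tau @: Z == Z]].
Let sg := tperm a b.

Let HP tau : tau \in H -> [/\ tau a = a, tau b = b & tau @: Z = Z].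
Proof. by rewrite inE => /and3P[/eqP ? /eqP ? /eqP ?]. Qed.

Let HM h tau : h \in H -> (h * tau \in H)%g = (tau \in H).
Proof. by move=> /HP[ha hb hZ]; rewrite !inE !permM ha hb imset_permM hZ. Qed.

Let orbit_sum X : weight m := \sum_(tau in H) one_ballot (tau @: X).

Let orbit_sumH h X : h \in H -> orbit_sum (h @: X) = orbit_sum X.
Proof.
move=> hH; rewrite /orbit_sum [RHS](reindex_inj (mulgI h)) /=.
by apply: eq_big => tau; rewrite ?HM // => _; rewrite imset_permM.
Qed.

(** Elements of [H] fix [a] and [b], hence commute with [sg]. *)
Let orbit_sum_sg X : wact sg (orbit_sum X) = orbit_sum (sg @: X).
Proof.
rewrite wact_sum; apply: eq_bigr => tau /HP[ta tb _]; rewrite wact_one -!imset_permM.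
suff -> : (tau * sg = sg * tau)%g by [].
apply/permP => x; rewrite !permM /sg.
case: (tpermP a b x) => [->|->|/eqP xa /eqP xb]; rewrite ?ta ?tb ?tpermL ?tpermR //.
by rewrite tpermD // eq_sym; [rewrite -ta | rewrite -tb]; rewrite (inj_eq perm_inj).
Qed.

Let rep := initial_subset Z.
Let rep_sub := initial_subset_sub Z.
Let rep_card := @initial_subset_card _ Z.

(** Listing [a], [b], then the subset, then the rest of [Z], and matching two such lists entry by
    entry, gives an element of [H]. *)
Let H_trans (Y C : {set 'I_m}) : Y \subset Z -> C \subset Z -> #|Y| = #|C| ->
  exists2 h, h \in H & h @: Y = C.
Proof.
move=> YZ CZ YC.
pose sq (Y : {set 'I_m}) := [:: a, b & enum Y ++ enum (Z :\: Y)].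
have squ (D : {set 'I_m}) : D \subset Z -> uniq (sq D).
  move=> DZ; rewrite /= inE negb_or ab /= !mem_cat !mem_enum !inE.
  rewrite (negbTE aZ) (negbTE bZ) !andbF !orbF.
  rewrite !(contraNN (fintype.subsetP DZ _) _) //= cat_uniq !enum_uniq andbT /=.
  by apply/hasPn => x; rewrite !mem_enum !inE => /andP[].
have sqs (D : {set 'I_m}) : D \subset Z -> size (sq D) = k.+1.
  move=> DZ; rewrite /= size_cat -!cardE cardsD (setIidPr DZ) subnKC ?Zk //.
  exact: subset_leq_card.
have [|h [ha hb hcat]] := perm_of_uniq_seqs (squ _ YZ) (squ _ CZ); first by rewrite !sqs.
have sz : size (enum Y) = size (enum C) by rewrite -!cardE.
move: hcat; rewrite map_cat => /eqP; rewrite eqseq_cat ?size_map // => /andP[/eqP h1 /eqP h2].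
have eY : h @: Y = C.
  by apply: (@imset_of_map _ _ _ _ (enum Y)) => x; rewrite ?h1 mem_enum.
exists h => //; rewrite inE ha hb !eqxx /=; apply/eqP.
rewrite -{1}(setID Z Y) imsetU (setIidPr YZ) eY -[RHS](setID Z C) (setIidPr CZ).
congr (_ :|: _); apply: (@imset_of_map _ _ _ _ (enum (Z :\: Y))) => x.
  by rewrite mem_enum.
by rewrite h2 mem_enum.
Qed.

(** Ballots separating [a] from [b] lose their candidates outside [a |: (b |: Z)] and stay nonempty;
    all others are fixed by [sg] and are left whole. *)
Let reduce X := if (a \in X) == (b \in X) then X else X :&: (a |: (b |: Z)).
Let D (l : nat) : weight m := orbit_sum (b |: rep l) - orbit_sum (a |: rep l).

Let orbit_sum_rep x X : x \in [:: a; b] -> 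
  orbit_sum (x |: (X :&: Z)) = orbit_sum (x |: rep #|X :&: Z|).
Proof.
have [|h hH <-] := @H_trans (X :&: Z) (rep #|X :&: Z|) (subsetIr _ _) (rep_sub _).
  by rewrite rep_card // subset_leq_card // subsetIr.
rewrite !inE => xab; rewrite -(orbit_sumH (x |: X :&: Z) hH) imsetU1.
by have [ha hb _] := HP hH; case/orP: xab => /eqP ->; rewrite ?ha ?hb.
Qed.

(** After reduction, transitivity of [H] leaves only the size of [X :&: Z]; the factor is 1, -1 or 0
    according to which of [a] and [b] lie in [X]. *)
Let orbit_sum_swap X : wact sg (orbit_sum (reduce X)) - orbit_sum (reduce X) =
  D #|X :&: Z| *~ ((a \in X)%:Z - (b \in X)%:Z).
Proof.
have fixC l : sg @: rep l = rep l.
  apply: imset_tperm_fix.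
  by rewrite !(contraNF (fintype.subsetP (rep_sub l) _) _).
rewrite /reduce; case: (boolP (a \in X)); case: (boolP (b \in X)) => bX aX /=.
- by rewrite orbit_sum_sg imset_tperm_fix ?aX ?bX // !subrr mulr0z.
- have -> : X :&: (a |: (b |: Z)) = a |: (X :&: Z).
    apply/setP => x; rewrite !inE; case: (eqVneq x a) => [->|_]; first by rewrite aX.
    by case: (eqVneq x b) => [->|//]; rewrite (negbTE bX).
  rewrite orbit_sum_rep ?inE ?eqxx // orbit_sum_sg imsetU1 fixC.
  by rewrite tpermL subr0 mulr1z.
- have -> : X :&: (a |: (b |: Z)) = b |: (X :&: Z).
    apply/setP => x; rewrite !inE; case: (eqVneq x b) => [->|_].
      by rewrite bX /= orbT.
    by case: (eqVneq x a) => [->|//]; rewrite (negbTE aX).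
  rewrite orbit_sum_rep ?inE ?eqxx ?orbT // orbit_sum_sg imsetU1 fixC.
  by rewrite tpermR sub0r mulrNz mulr1z /D opprB.
- by rewrite orbit_sum_sg imset_tperm_fix ?(negbTE aX) ?(negbTE bX) // !subrr mulr0z.
Qed.

(** Reducing the ballots and summing over [H] gives a count fixed by [sg], which elects [b |: Z]
    along with [a |: Z]; cancellation carries this back to [v]. Nonnegativity of [v] makes the
    reduction a sum of loser trades, without inverses of such trades. *)
Lemma swap_diff0_ge0 v : (forall X, 0 <= v X) -> swap_diff v = 0 ->
  a |: Z \in F v -> b |: Z \in F v.
Proof.
move=> v0 dv Wv; have Wk := wr_card FR Wv.
have W'k : #|b |: Z| = k by rewrite cardsU1 bZ.
pose r := \sum_X (one_ballot (reduce X) - one_ballot X) *+ `|v X|%N.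
have rE W : #|W| = k -> W :&: (a |: (b |: Z)) = W -> W \in F r.
  move=> Wk' Wab; apply: rule_sum => // X _; apply: ruleMn; rewrite /reduce.
  case: eqVneq => abX; first by rewrite subrr rule0.
  apply: (wr_losers FR) => //; rewrite ?subsetIl //.
    apply/set0Pn; move: abX; case: (boolP (a \in X)) => [aX _|aX].
      by exists a; rewrite !inE aX eqxx.
    by case: (boolP (b \in X)) => // bX _; exists b; rewrite !inE bX eqxx orbT.
  by rewrite setIA [W :&: X]setIC -setIA Wab setIC.
have vrE : v + r = \sum_X one_ballot (reduce X) *~ v X.
  rewrite {1}[v]weight_basis -big_split; apply: eq_bigr => X _ /=.
  by rewrite mulrnBl !pmulrn gez0_abs // addrC subrK.
have Wr : a |: Z \in F r.
  by apply: rE => //; apply/setIidPl/setUS/subsetUr.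
have W'r : b |: Z \in F r.
  by apply: rE => //; apply/setIidPl; rewrite subsetUr.
pose u := \sum_(tau in H) wact tau (v + r).
have uE : u = \sum_X orbit_sum (reduce X) *~ v X.
  rewrite /u vrE; under eq_bigr do rewrite wact_sum.
  rewrite exchange_big; apply: eq_bigr => X _; rewrite /orbit_sum mulrz_suml.
  by apply: eq_bigr => tau _; rewrite wactMz wact_one.
have Wu tau : tau \in H -> a |: Z \in F (wact tau (v + r)).
  move=> /HP[ta _ tZ]; have -> : a |: Z = tau @: (a |: Z) by rewrite imsetU1 ta tZ.
  by rewrite (wr_neutral FR) ruleD.
(* The change under [sg] is the sum over [l] of the multiples of [D l] by the entries of
   [swap_diff], all zero. *)
have ufix : wact sg u = u.
  apply/eqP; rewrite -subr_eq0 uE wact_sum -sumrB.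
  under eq_bigr do rewrite wactMz -mulrzBl orbit_sum_swap -mulrzA.
  rewrite (eq_bigr (fun X => \sum_(l < k) D l *~
    (v X * ((a \in X)%:Z - (b \in X)%:Z) * (#|X :&: Z| == l)%:Z))); last first.
    move=> X _; rewrite (bigD1 (Ordinal (card_capZ X))) //= eqxx mulr1 big1 ?addr0.
      by rewrite mulrC.
    move=> l lX; case: eqVneq => [e|_]; last by rewrite mulr0 mulr0z.
    by case/eqP: lX; apply: val_inj.
  rewrite exchange_big big1 //= => l _; rewrite -mulrz_sumr.
  by have /ffunP/(_ l) := dv; rewrite !ffunE => ->; rewrite mulr0z.
have W'u : b |: Z \in F u.
  have e : b |: Z = sg @: (a |: Z).
    by rewrite imsetU1 tpermL imset_tperm_fix // (negbTE aZ) (negbTE bZ).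
  by rewrite -ufix e (wr_neutral FR); apply: rule_sum.
(* The identity singles out [v + r] as a summand of [u]; then [r] is cancelled. *)
have H1 : 1%g \in H by rewrite inE !perm1 !eqxx imset_perm1 eqxx.
have := rule_sum_sub H1 Wu W'u; rewrite wact1.
exact: rule_subl Wv Wr.
Qed.

Lemma swap_diff0 v : swap_diff v = 0 -> a |: Z \in F v -> b |: Z \in F v.
Proof.
move=> dv Wv; rewrite -(wr_const FR v (shift v)); apply: swap_diff0_ge0.
- by move=> X; rewrite weightD weight_cst; apply/ltW/shiftP.
- by rewrite swap_diffD dv swap_diff_cst addr0.
- by rewrite (wr_const FR).
Qed.

End Swap.
End WeightRule.

(** * The scoring function from adjacent comparisons *)

Section Adjacent.
Local Open Scope ring_scope.
Variables (R : realType) (m k : nat) (F : weight m -> {set {set 'I_m}}).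
Hypothesis FR : weight_rule k F.
Implicit Types (v w : weight m) (W X Z : {set 'I_m}) (tau : {perm 'I_m}).

Lemma swap_diff_one (Z : {set 'I_m}) a b X (l : 'I_k) :
  swap_diff k Z a b (one_ballot X) l =
  ((a \in X)%:Z - (b \in X)%:Z) * (#|X :&: Z| == l)%:Z.
Proof.
rewrite ffunE (bigD1 X) //= one_ballotE eqxx mul1r big1 ?addr0 // => Y YX.
by rewrite one_ballotE (negbTE YX) !mul0r.
Qed.

Lemma exchange_step (W W' : {set 'I_m}) : #|W| = #|W'| -> W != W' ->
  exists Z a b, [/\ a \notin Z, b \notin Z, a != b, W = a |: Z & b \in W' /\ a \notin W'].
Proof.
move=> e ne; have : ~~ (W \subset W') by apply: contraNN ne => h; rewrite eqEcard h e leqnn.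
have : ~~ (W' \subset W) by apply: contraNN ne => h; rewrite eq_sym eqEcard h e leqnn.
move=> /fintype.subsetPn[b bW' bW] /fintype.subsetPn[a aW aW'].
have ab : a != b by apply: contraNneq bW => <-.
exists (W :\ a), a, b; rewrite !inE eqxx (negbTE bW) andbF setD1K //; split=> //.
Qed.

(** Each exchange trades a member outside [W'] for a member of [W'], which shrinks [W :\: W']. *)
Lemma committee_ind (P : {set 'I_m} -> Prop) W W' : #|W| = #|W'| -> P W ->
  (forall Z a b, a \notin Z -> b \notin Z -> a != b -> #|Z|.+1 = #|W| ->
    P (a |: Z) -> P (b |: Z)) -> P W'.
Proof.
move=> e PW step; elim: {W}_.+1 {-2}W (ltnSn #|W :\: W'|) e PW step => // n IH W lt e PW step.
have [<- //|ne] := eqVneq W W'.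
have [Z [a [b [aZ bZ ab WE [bW' aW']]]]] := exchange_step e ne.
have cW : #|Z|.+1 = #|W| by rewrite WE cardsU1 aZ.
have cb : #|b |: Z| = #|W| by rewrite cardsU1 bZ.
apply: (IH (b |: Z)); rewrite ?cb //; last by apply: step aZ bZ ab cW _; rewrite -WE.
rewrite ltnS in lt; apply: leq_trans lt; apply: proper_card; apply/properP; split.
  apply/fintype.subsetP => x; rewrite WE !inE => /andP[xW'].
  by case: (eqVneq x b) xW' => [->|_]; rewrite ?bW' // => -> /= ->; rewrite orbT.
exists a; first by rewrite WE !inE eqxx aW'.
by rewrite !inE (negbTE ab) (negbTE aZ) andbF.
Qed.

Lemma nontrivial_swap v0 W0 : #|W0| = k -> W0 \notin F v0 ->
  exists v Z a b, [/\ a \notin Z, b \notin Z, a != b, #|Z|.+1 = k &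
    a |: Z \in F v /\ b |: Z \notin F v].
Proof.
move=> W0k W0v; have [W1 W1v] := set0Pn _ (wr_neq0 FR v0).
have W1k := wr_card FR W1v; apply: contrapT => no.
move: W0v; apply/negP/negPn.
apply: (committee_ind (P := fun W => W \in F v0) (etrans W1k (esym W0k)) W1v); rewrite W1k.
move=> Z a b aZ bZ ab Zk av; apply: contrapT => /negP bv.
by apply: no; exists v0, Z, a, b.
Qed.

(** Only ballots with exactly one of [a] and [b] matter; with [l] members in [Z], such a ballot
    changes the score by [s l.+1 - s l = delta l]. *)
Lemma score_swap (delta : 'I_k -> R) (s : nat -> R) v Z a b :
  (forall n, s n = \sum_(i < k | (i < n)%N) delta i) ->
  a \notin Z -> b \notin Z -> #|Z|.+1 = k ->
  score s v (a |: Z) - score s v (b |: Z) = \sum_l delta l *~ swap_diff k Z a b v l.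
Proof.
move=> sE aZ bZ Zk; rewrite -sumrB.
under [RHS]eq_bigr do rewrite ffunE mulrz_sumr.
rewrite exchange_big; apply: eq_bigr => X _ /=.
have capk := card_capZ Zk X.
have card x : x \notin Z -> #|X :&: (x |: Z)| = ((x \in X) + #|X :&: Z|)%N.
  move=> xZ; case: (boolP (x \in X)) => xX.
    rewrite (_ : X :&: _ = x |: (X :&: Z)); first by rewrite cardsU1 !inE (negbTE xZ) andbF.
    by apply/setP => y; rewrite !inE; case: eqVneq => [->|//]; rewrite xX.
  rewrite add0n; apply: eq_card => y; rewrite !inE.
  by case: eqVneq => [->|//]; rewrite (negbTE xX).
have sS n (nk : (n < k)%N) : s n.+1 = delta (Ordinal nk) + s n.
  rewrite !sE (bigD1 (Ordinal nk)) //=; congr (_ + _); apply: eq_bigl => i.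
  by rewrite -val_eqE /= ltnS; lia.
rewrite (bigD1 (Ordinal capk)) //= eqxx mulr1 big1 ?addr0; last first.
  move=> l lX; case: eqVneq => [e|_]; last by rewrite mulr0 mulr0z.
  by case/eqP: lX; apply: val_inj.
rewrite !card // [v X * _]mulrC mulrzA -mulrzBl; congr (_ *~ _).
case: (a \in X); case: (b \in X); rewrite /= ?add0n ?add1n ?sS ?subrr ?mulr0z //.
  by rewrite addrK subr0 mulr1z.
by rewrite sub0r mulrNz mulr1z opprD addrCA subrr addr0.
Qed.

(** The cone comes from one adjacent pair that [F] separates. The functional supplies the increments
    of [s]: their signs give monotonicity, their sum 1 gives a strict step. *)
Lemma adjacent_scoring v0 W0 : #|W0| = k -> W0 \notin F v0 ->
  exists s : nat -> R, [/\ s 0%N = 0, {homo s : i j / (i <= j)%N >-> i <= j},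
    exists j, (0 < j <= k)%N /\ s j.-1 < s j &
    forall v Z a b, a \notin Z -> b \notin Z -> a != b -> #|Z|.+1 = k ->
      a |: Z \in F v -> score s v (b |: Z) <= score s v (a |: Z)].
Proof.
move=> W0k W0v; have [v1 [Z [a [b [aZ bZ ab Zk [av bv]]]]]] := nontrivial_swap W0k W0v.
pose d := swap_diff k Z a b.
have dD v w : d (v + w) = d v + d w by apply: swap_diffD.
pose K x := exists2 v, d v = x & a |: Z \in F v.
have Wk : #|a |: Z| = k by rewrite cardsU1 aZ.
have d0 : d 0 = 0.
  by apply: (@addrI _ (d 0)); rewrite -dD !addr0.
have K0 : K 0 by exists 0 => //; apply: (rule0 FR).
have KD x y : K x -> K y -> K (x + y).
  move=> [v <- Wv] [w <- Ww]; exists (v + w); rewrite ?dD //; exact: (ruleD FR).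
have Ke (l : 'I_k) : K [ffun j => (j == l)%:Z].
  have lZ : (l <= #|Z|)%N by rewrite -ltnS Zk.
  have [C CZ Cl] : exists2 C : {set 'I_m}, C \subset Z & #|C| = l.
    by exists (initial_subset Z l); [apply: initial_subset_sub | exact: initial_subset_card].
  have aC : a \notin C by apply: contraNN aZ => /(fintype.subsetP CZ).
  have bC : b \notin C by apply: contraNN bZ => /(fintype.subsetP CZ).
  (* Dropping the loser [b] from a ballot with [l] members in [Z] realises the unit vector at
     [l]. *)
  exists (one_ballot (a |: C) - one_ballot (a |: (b |: C))); last first.
    apply: (wr_losers FR) => //.
    - by apply/set0Pn; exists a; rewrite !inE eqxx.
    - by apply: setUS; apply: subsetUr.
    - apply/setP => x; rewrite !inE; case: (eqVneq x b) => [->|//].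
      by rewrite [b == a]eq_sym (negbTE ab) (negbTE bZ).
  have dN v : d (- v) = - d v by apply: (@addrI _ (d v)); rewrite -dD !subrr d0.
  apply/ffunP => j; rewrite dD dN.
  have -> x y : (x - y : {ffun 'I_k -> int}) j = x j - y j by rewrite !ffunE.
  have capZ : (a |: C) :&: Z = C.
    apply/setP => x; rewrite !inE; case: (eqVneq x a) => [->|_] /=.
      by rewrite (negbTE aZ) (negbTE aC).
    by case: (boolP (x \in C)) => // /(fintype.subsetP CZ) ->.
  rewrite /d !swap_diff_one capZ Cl !inE !eqxx !orbT subrr mul0r subr0 [b == a]eq_sym.
  by rewrite (negbTE ab) (negbTE bC) subr0 mul1r ffunE eq_sym.
have KM x n : K x -> K (x *+ n).
  by move=> Kx; elim: n => [|n IH]; rewrite ?mulr0n // mulrS; apply: KD.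
have Kpos (x : {ffun 'I_k -> int}) : (forall l, 0 <= x l) -> K x.
  move=> x0; have -> : x = \sum_i [ffun j => (j == i)%:Z] *+ `|x i|%N.
    apply/ffunP => j; rewrite sum_ffunE (bigD1 j) //= ffunMnE ffunE eqxx big1.
      by rewrite addr0 natz gez0_abs.
    by move=> i ij; rewrite ffunMnE ffunE eq_sym (negbTE ij) mul0rn.
  by elim/big_rec: _ => // i y _ Ky; apply: KD => //; apply: KM.
have Kn1 : ~ K [ffun=> -1].
  (* The bound [n] dominates every entry of [d v1], so [- d v1] would lie in [K]. A count [w]
     realising it gives [v1 + w] zero difference, so [b |: Z] would win there and, by cancellation,
     at [v1]. *)
  move=> Kn; pose n := \sum_l `|d v1 l|%N.
  have [w dw Ww] : K (- d v1).
    have -> : - d v1 = [ffun=> -1] *+ n + ([ffun=> n%:Z] - d v1).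
      apply/ffunP => l; rewrite addrA; suff -> : [ffun=> -1] *+ n + [ffun=> n%:Z] = 0 :> {ffun 'I_k -> int}.
        by rewrite add0r.
      apply/ffunP => i; rewrite ffunE ffunMnE !ffunE mulNrn natz; lia.
    apply: KD; first exact: KM.
    apply: Kpos => l; have -> x y : (x - y : {ffun 'I_k -> int}) l = x l - y l by rewrite !ffunE.
    rewrite ffunE /n (bigD1 l) //= PoszD; lia.
  case/negP: bv; apply: (rule_subl FR av Ww).
  apply: (swap_diff0 FR aZ bZ ab Zk); last exact: (ruleD FR).
  by rewrite -/(d _) dD dw subrr.
have [delta [dge0 dsum dpos]] := @positive_functional R k K K0 KD Ke Kn1.
pose s n := \sum_(i < k | (i < n)%N) delta i.
exists s; split.
- by rewrite /s big1.
- move=> i j ij; rewrite /s [leRHS](bigID (fun l : 'I_k => (l < i)%N)) /=.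
  rewrite [X in _ <= X + _](eq_bigl (fun l : 'I_k => (l < i)%N)) ?lerDl ?sumr_ge0 // => l.
  by apply/andP/idP => [[]|li] //; split=> //; apply: leq_trans li ij.
- have [l dl] : exists l, 0 < delta l.
    apply: contrapT => no; suff : \sum_i delta i = 0 by move/eqP; rewrite dsum oner_eq0.
    apply: big1 => i _; apply/eqP; rewrite eq_le dge0 andbT leNgt; apply/negP => di.
    by apply: no; exists i.
  exists l.+1; split; first by rewrite ltn_ord.
  rewrite /s [ltRHS](bigD1 l) //= [X in _ < _ + X](eq_bigl (fun i : 'I_k => (i < l)%N)) ?ltrDr // => i.
  rewrite -val_eqE /= ltnS; lia.
- move=> v Z' a' b' aZ' bZ' ab' Zk' Wv.
  (* Neutrality carries any other adjacent pair to the fixed one. *)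
  pose sq (Y : {set 'I_m}) (x y : 'I_m) := [:: x, y & enum Y].
  have squ (Y : {set 'I_m}) x y : x \notin Y -> y \notin Y -> x != y -> uniq (sq Y x y).
    by move=> xY yY xy; rewrite /= inE negb_or xy !mem_enum xY yY enum_uniq.
  have [|tau [ta tb tZ]] := perm_of_uniq_seqs (squ _ _ _ aZ' bZ' ab') (squ _ _ _ aZ bZ ab).
    by apply/eqP; rewrite /= -!cardE !eqSS -eqSS Zk Zk'.
  have tZ' : tau @: Z' = Z.
    by apply: (@imset_of_map _ _ _ _ (enum Z')) => x; rewrite ?tZ mem_enum.
  rewrite -(score_act s tau _ (b' |: Z')) -(score_act s tau _ (a' |: Z')).
  rewrite !imsetU1 ta tb tZ' -subr_ge0 (score_swap _ (fun=> erefl) aZ bZ Zk).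
  apply: dpos; exists (wact tau v) => //.
  have -> : a |: Z = tau @: (a' |: Z') by rewrite imsetU1 ta tZ'.
  by rewrite (wr_neutral FR).
Qed.

End Adjacent.

(** * Intermediate sets and involutions swapping disjoint sets *)

Lemma card_intermediate (T : finType) (E V : {set T}) j :
  E \subset V -> (#|E| <= j)%N ->
  #|[set D : {set T} | [&& E \subset D, D \subset V & #|D| == j]]| =
  'C(#|V| - #|E|, j - #|E|).
Proof.
move=> EV Ej; rewrite -[in RHS](setIidPr EV) -cardsD -cards_draws.
have <- : (fun D : {set T} => E :|: D) @:
    [set D : {set T} | D \subset V :\: E & #|D| == (j - #|V :&: E|)%N] =
    [set D : {set T} | [&& E \subset D, D \subset V & #|D| == j]].
  rewrite (setIidPr EV); apply/setP => D; rewrite inE; apply/imsetP/and3P.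
    move=> [D']; rewrite inE subsetD => /andP[/andP[D'V dis] /eqP cD'] ->.
    rewrite subsetUl subUset EV D'V; split=> //.
    by rewrite cardsU setIC (disjoint_setI0 dis) cards0 subn0 cD' subnKC.
  move=> [ED DV /eqP cD]; exists (D :\: E); last by rewrite -{1}(setID D E) (setIidPr ED).
  by rewrite inE setSD //= cardsD (setIidPr ED) cD.
rewrite card_in_imset // => D1 D2; rewrite !inE !subsetD => /andP[/andP[_ d1] _] /andP[/andP[_ d2] _] e.
have h (D : {set T}) : [disjoint D & E] -> (E :|: D) :\: E = D.
  by move=> d; rewrite setDUl setDv set0U; apply/setDidPl.
by rewrite -(h D1) // e h.
Qed.

(** A bijection from [A] to [B] is used forwards on [A] and backwards on [B]. *)
Lemma swap_perm (T : finType) (A B : {set T}) : [disjoint A & B] -> #|A| = #|B| ->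
  exists sg : {perm T}, [/\ (sg * sg = 1)%g, sg @: A = B, sg @: B = A &
    forall x, x \notin A -> x \notin B -> sg x = x].
Proof.
move=> dAB cAB; have [tau tA] := imset_transitive cAB.
have inB x : (tau x \in B) = (x \in A) by rewrite -tA mem_imset //; apply: perm_inj.
have nAB x : x \in B -> x \in A = false.
  by move=> xB; apply/negP => xA; move/disjointFr: dAB => /(_ _ xA); rewrite xB.
pose h x := if x \in A then tau x else if x \in B then (tau^-1)%g x else x.
have hK : involutive h.
  move=> x; rewrite {2}/h; case: (boolP (x \in A)) => xA.
    by rewrite /h nAB ?inB ?xA ?permK.
  case: (boolP (x \in B)) => xB; last by rewrite /h (negbTE xA) (negbTE xB).
  by rewrite /h -inB permKV xB.
exists (perm (inv_inj hK)).
have hA : perm (inv_inj hK) @: A = B.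
  by rewrite -tA; apply: eq_in_imset => x xA; rewrite permE /h xA.
have hh : (perm (inv_inj hK) * perm (inv_inj hK) = 1)%g.
  by apply/permP => x; rewrite permM !permE hK.
split=> //; last by move=> x xA xB; rewrite permE /h (negbTE xA) (negbTE xB).
by rewrite -hA -imset_comp (eq_imset (g := id)) ?imset_id // => x /=; rewrite -permM hh perm1.
Qed.

(** * From local to global optimality *)

Section Global.
Local Open Scope ring_scope.
Variables (R : realType) (m k : nat) (F : weight m -> {set {set 'I_m}}).
Hypothesis FR : weight_rule k F.
Variable s : nat -> R.
Hypothesis s0 : s 0%N = 0.
Hypothesis adj : forall v (Z : {set 'I_m}) a b, a \notin Z -> b \notin Z -> a != b -> #|Z|.+1 = k ->
  a |: Z \in F v -> score s v (b |: Z) <= score s v (a |: Z).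
Implicit Types (v w : weight m) (D V W X Z : {set 'I_m}) (tau : {perm 'I_m}).

Lemma score_exchange v W a b : W \in F v -> a \in W -> b \notin W ->
  score s v (b |: (W :\ a)) <= score s v W.
Proof.
move=> Wv aW bW; have Wk := wr_card FR Wv.
rewrite -{2}(setD1K aW); apply: adj; rewrite ?setD1K //.
- by rewrite !inE eqxx.
- by rewrite !inE (negbTE bW) andbF.
- by apply: contraNneq bW => <-.
- by rewrite -Wk (cardsD1 a W) aW.
Qed.

Lemma card_exchange W a b : a \in W -> b \notin W -> #|b |: (W :\ a)| = #|W|.
Proof. by move=> aW bW; rewrite cardsU1 !inE (negbTE bW) andbF (cardsD1 a W) aW. Qed.

(** Linear scores are sums of candidate values [sc]. Exchanges show that each member of [W :\: X] is
    worth at least each member of [X :\: W], and a bijection between these sets adds up the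
    inequalities. *)
Lemma global_linear v W X : (forall i, (i <= k)%N -> s i = s 1%N *+ i) ->
  W \in F v -> #|X| = k -> score s v X <= score s v W.
Proof.
move=> lin Wv Xk; have Wk := wr_card FR Wv.
pose sc x := \sum_(Y : {set 'I_m} | x \in Y) s 1%N *~ v Y.
have scE V : #|V| = k -> score s v V = \sum_(x in V) sc x.
  move=> Vk; rewrite (exchange_big_dep xpredT) //=; apply: eq_bigr => Y _.
  rewrite lin -?Vk ?subset_leq_card ?subsetIr // pmulrn mulrzAC -pmulrn -sumr_const.
  by apply: eq_bigl => x; rewrite !inE andbC.
have sc_le a b : a \in W :\: X -> b \in X :\: W -> sc b <= sc a.
  rewrite !inE => /andP[_ aW] /andP[bW _].
  have := score_exchange Wv aW bW; rewrite !scE ?card_exchange //.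
  by rewrite big_setU1 ?inE ?(negbTE bW) ?andbF //= [leRHS](big_setD1 a) //= lerD2r.
have cAB : #|W :\: X| = #|X :\: W|.
  by apply: (@addnI #|W :&: X|); rewrite cardsID [W :&: X]setIC cardsID Wk Xk.
rewrite !scE // (big_setID W) /= [leRHS](big_setID X) /= [X :&: W]setIC lerD2l.
have [tau tA] := imset_transitive cAB.
rewrite -tA big_imset /=; last by move=> x y _ _; apply: perm_inj.
by apply: ler_sum => a aA; apply: sc_le => //; rewrite -tA imset_f.
Qed.

(** * Bilinear functions of committees as scores *)

Section NonLinear.
Variable j : nat.
Hypotheses (jk : (j <= k)%N) (j_nonlin : s j != s 1%N *+ j)
  (j_min : forall i, (i < j)%N -> s i = s 1%N *+ i).

Lemma j_ge2 : (2 <= j)%N.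
Proof.
by move: j_nonlin; case: (j) => [|[|//]]; rewrite ?s0 ?mulr0n ?mulr1n eqxx.
Qed.

(* Below [j] the function [s] is linear, so only supersets of [D] see this weight. *)
Definition test_ballot (D : {set 'I_m}) : weight m :=
  (one_ballot D - \sum_(x in D) one_ballot [set x]) *~ sgz (s j - s 1%N *+ j).

(** If [D] is not inside [V], then [#|D :&: V| < j] lies in the linear range and the terms cancel;
    the factor [sgz] turns the deviation at [j] into its absolute value. *)
Lemma score_test_ballot D V : #|D| = j ->
  score s (test_ballot D) V = `|s j - s 1%N *+ j| * (D \subset V)%:R.
Proof.
move=> Dj; have scoreMz u (z : int) : score s (u *~ z) V = score s u V *~ z.
  by case: z => n; rewrite ?NegzE ?mulrNz ?scoreN -!pmulrn scoreMn.
rewrite /test_ballot scoreMz scoreD scoreN score_sum score_one.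
under eq_bigr do rewrite score_one.
have -> : \sum_(x in D) s #|[set x] :&: V| = s 1%N *+ #|D :&: V|.
  rewrite -sumr_const [LHS](bigID (mem V)) /= [X in _ + X]big1 ?addr0.
    apply: eq_big => x; rewrite ?inE // => /andP[_ xV].
    by rewrite (setIidPl _) ?cards1 // sub1set.
  move=> x /andP[_ xV]; rewrite (_ : [set x] :&: V = set0) ?cards0 //.
  by apply/disjoint_setI0; rewrite disjoints1.
case: (boolP (D \subset V)) => DV.
  by rewrite (setIidPl DV) Dj mulr1 -mulrzl -sgrEz -normrEsg.
rewrite j_min ?subrr ?mul0rz ?mulr0 // -Dj; apply: proper_card.
by rewrite properEneq subsetIl andbT; apply: contraNneq DV => <-; rewrite subsetIr.
Qed.

(** The number of [j]-sets between [[set x; y]] and [V] is the same for all committees [V]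
    containing both points, and zero for the others. *)
Definition pair_weight (x y : 'I_m) : weight m :=
  \sum_(D : {set 'I_m} | ([set x; y] \subset D) && (#|D| == j)) test_ballot D.

Definition pair_const : R := `|s j - s 1%N *+ j| *+ 'C(k - 2, j - 2).

Lemma pair_const_gt0 : 0 < pair_const.
Proof.
have c0 : 0 < `|s j - s 1%N *+ j| by rewrite normr_gt0 subr_eq0.
by rewrite /pair_const pmulrn_rgt0 // bin_gt0 leq_sub2r.
Qed.

Lemma score_pair_weight x y V : x != y -> #|V| = k ->
  score s (pair_weight x y) V = pair_const * ((x \in V) && (y \in V))%:R.
Proof.
move=> xy Vk; have cxy : #|[set x; y]| = 2%N by rewrite cards2 xy.
rewrite score_sum (eq_bigr (fun D => `|s j - s 1%N *+ j| * (D \subset V)%:R)); last first.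
  by move=> D /andP[_ /eqP Dj]; rewrite score_test_ballot.
rewrite (_ : (x \in V) && (y \in V) = ([set x; y] \subset V)); last first.
  by rewrite subUset !sub1set.
case: (boolP ([set x; y] \subset V)) => xyV.
  have := card_intermediate (j := j) xyV; rewrite cxy Vk => /(_ j_ge2) cE.
  rewrite mulr1 /pair_const -cE.
  rewrite -sumr_const big_mkcond [RHS]big_mkcond; apply: eq_bigr => D _.
  rewrite inE; case: (_ \subset D) => //=; case: (D \subset V); case: (_ == j) => //=;
    by rewrite ?mulr1 ?mulr0.
rewrite mulr0; apply: big1 => D /andP[xyD _].
by rewrite (_ : (D \subset V) = false) ?mulr0 //; apply/negP => /(subset_trans xyD); apply/negP.
Qed.

(** * The inductive step on the distance between committees *)

Section Step.
Variables (t : nat) (W X : {set 'I_m}).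
Hypothesis t_ge2 : (2 <= t)%N.
Hypothesis IH : forall v V V', #|V'| = k -> V \in F v -> (#|V :\: V'| < t)%N ->
  score s v V' <= score s v V.
Hypotheses (Wk : #|W| = k) (Xk : #|X| = k) (WXt : #|W :\: X| = t).

Let A := W :\: X.
Let B := X :\: W.
Let kap := pair_const.

Let cA : #|A| = t. Proof. by []. Qed.
Let cB : #|B| = t.
Proof.
by rewrite -WXt; apply: (@addnI #|X :&: W|); rewrite cardsID [X :&: W]setIC cardsID Wk Xk.
Qed.
Let dAB : [disjoint A & B].
Proof.
rewrite -setI_eq0; apply/eqP/setP => x; rewrite !inE.
by case: (x \in W); case: (x \in X).
Qed.
Let k_ge2 : (2 <= k)%N.
Proof. by rewrite -Wk (leq_trans t_ge2) // -WXt subset_leq_card // subsetDl. Qed.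
Let kap_gt0 : 0 < kap. Proof. exact: pair_const_gt0. Qed.

Let sum_indicator (S V : {set 'I_m}) : \sum_(x in S) ((x \in V)%:R : R) = #|V :&: S|%:R.
Proof.
rewrite -natr_sum -sum1_card big_mkcond [X in _ = X%:R]big_mkcond.
by congr _%:R; apply: eq_bigr => x _; rewrite !inE; case: (x \in S); case: (x \in V).
Qed.

(** Its score vanishes at [W] and [X] and is positive strictly between them. *)
Let product_weight : weight m := \sum_(x in A) \sum_(y in B) pair_weight x y.
(** A member [x] of [V] pairs with exactly [k - 1] others, so the bilinear weights also yield a
    linear function. *)
Let linear_weight (S : {set 'I_m}) : weight m :=
  \sum_(x in S) \sum_(y | y != x) pair_weight x y.

Let score_product_weight V : #|V| = k ->
  score s product_weight V = kap * (#|V :&: A| * #|V :&: B|)%:R.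
Proof.
move=> Vk; rewrite score_sum natrM -!sum_indicator mulr_suml mulr_sumr.
apply: eq_bigr => x xA; rewrite score_sum mulrA mulr_sumr; apply: eq_bigr => y yB.
rewrite score_pair_weight //; first by rewrite -mulrA -natrM mulnb.
by apply: contraTneq xA => ->; rewrite (disjointFl dAB yB).
Qed.

Let score_linear_weight S V : #|V| = k ->
  score s (linear_weight S) V = kap * (k - 1)%:R * #|V :&: S|%:R.
Proof.
move=> Vk; rewrite score_sum -sum_indicator mulr_sumr; apply: eq_bigr => x xS.
rewrite score_sum (eq_bigr (fun y => kap * (x \in V)%:R * (y \in V)%:R)); last first.
  by move=> y yx; rewrite score_pair_weight 1?eq_sym // -mulrA -natrM mulnb.
rewrite -mulr_sumr; case: (boolP (x \in V)) => xV; last by rewrite !mulr0 mul0r.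
rewrite !mulr1; congr (_ * _).
rewrite (eq_bigl (mem [set~ x])); last by move=> y; rewrite !inE.
rewrite sum_indicator; congr _%:R; rewrite -Vk (cardsD1 x V) xV add1n subn1 /=.
by apply: eq_card => y; rewrite !inE andbC.
Qed.

Let wt V := (#|V :&: W| + #|V :&: X|)%N.

(** Adding the image under an involution exchanging [W] and [X] makes a weight invariant. The two
    scores are already symmetric, so they just double. *)
Let symmetric_weights : exists (sg : {perm 'I_m}) (Q Y : weight m) (kap' : R),
  [/\ 0 < kap', sg @: W = X, wact sg Q = Q /\ wact sg Y = Y,
   forall V, #|V| = k -> score s Q V = kap' * (#|V :&: A| * #|V :&: B|)%:R &
   forall V, #|V| = k -> score s Y V = kap' * (k - 1)%:R * (wt V)%:R].
Proof.
have [sg [sgsg sgA sgB sgfix]] := swap_perm dAB (etrans cA (esym cB)).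
have sgI : sg @: (W :&: X) = W :&: X.
  rewrite -[RHS]imset_id; apply: eq_in_imset => x; rewrite !inE => /andP[xW xX].
  by rewrite sgfix // !inE ?xW ?xX ?andbF.
have sgW : sg @: W = X by rewrite -{1}(setID W X) imsetU sgI sgA setIC setID.
have sgX : sg @: X = W by rewrite -{1}(setID X W) imsetU setIC sgI sgB setID.
have sgK V : sg @: (sg @: V) = V by rewrite -imset_permM sgsg imset_perm1.
have sgcap V (S S' : {set 'I_m}) : sg @: S = S' -> #|sg @: V :&: S'| = #|V :&: S|.
  move=> <-; rewrite -imsetI ?card_imset //; first exact: perm_inj.
  by move=> x y _ _; apply: perm_inj.
have sgk V : #|sg @: V| = #|V| by rewrite card_imset //; apply: perm_inj.
have score_sg u V : score s (wact sg u) V = score s u (sg @: V).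
  by rewrite -[V in LHS]sgK score_act.
pose Y0 := linear_weight W + linear_weight X.
exists sg, (product_weight + wact sg product_weight), (Y0 + wact sg Y0), (kap *+ 2).
split=> //.
- by rewrite pmulrn_rgt0.
- by split; rewrite wactD wactK // addrC.
- move=> V Vk; rewrite scoreD score_sg !score_product_weight ?sgk //.
  rewrite (sgcap V B A) // (sgcap V A B) // [(#|V :&: B| * _)%N]mulnC.
  by rewrite mulr2n mulrDl.
- move=> V Vk; rewrite scoreD score_sg !scoreD !score_linear_weight ?sgk //.
  rewrite (sgcap V X W) // (sgcap V W X) // /wt natrD; ring.
Qed.

(** By [wt_mid] and [not_mid] these are exactly the committees of maximal [wt]. *)
Let mid V := [&& #|V| == k, W :&: X \subset V & V \subset W :|: X].

Let wt_mid V : mid V -> wt V = (k + #|W :&: X|)%N.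
Proof.
move=> /and3P[/eqP Vk ZV VU]; rewrite /wt -cardsUI -setIUr (setIidPl VU) Vk.
by rewrite setIACA setIid (setIidPr ZV).
Qed.

Let midW : mid W. Proof. by rewrite /mid Wk eqxx subsetIl subsetUl. Qed.
Let midX : mid X. Proof. by rewrite /mid Xk eqxx subsetIr subsetUr. Qed.

Let midP V : mid V -> V != W -> V != X ->
  [/\ (#|V :\: X| < t)%N, (#|V :\: W| < t)%N, (#|W :\: V| < t)%N &
      (0 < #|V :&: A| * #|V :&: B|)%N].
Proof.
move=> /and3P[/eqP Vk ZV VU] VW VX.
have inAB x : x \in V -> (x \in W) || (x \in X) by move/(fintype.subsetP VU); rewrite inE.
have inZ x : x \in W -> x \in X -> x \in V.
  by move=> xW xX; apply: (fintype.subsetP ZV); rewrite inE xW.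
have nsub (S : {set 'I_m}) : #|S| = k -> V != S -> ~~ (V \subset S) /\ ~~ (S \subset V).
  move=> Sk VS; split; apply: contraNN VS => h; last rewrite eq_sym;
  by rewrite eqEcard h Vk Sk leqnn.
have [VnW WnV] := nsub W Wk VW; have [VnX XnV] := nsub X Xk VX.
have [x xV xX] := fintype.subsetPn VnX; have [y yV yW] := fintype.subsetPn VnW.
have [a aW aV] := fintype.subsetPn WnV; have [b bX bV] := fintype.subsetPn XnV.
have xW : x \in W by have := inAB x xV; rewrite (negbTE xX) orbF.
have yX : y \in X by have := inAB y yV; rewrite (negbTE yW).
have aX : a \notin X by apply: contraNN aV; apply: inZ.
have bW : b \notin W by apply: contraNN bV => bW; apply: inZ.
split.
- rewrite -cA; apply/proper_card/properP; split; last by exists a; rewrite !inE ?aX ?aV ?andbF.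
  by apply/fintype.subsetP => z; rewrite !inE => /andP[zX /inAB]; rewrite (negbTE zX) orbF.
- rewrite -cB; apply/proper_card/properP; split; last by exists b; rewrite !inE ?bW ?bV ?andbF.
  by apply/fintype.subsetP => z; rewrite !inE => /andP[zW /inAB]; rewrite (negbTE zW).
- rewrite -cA; apply/proper_card/properP; split; last by exists x; rewrite !inE ?xX ?xV.
  apply/fintype.subsetP => z; rewrite !inE => /andP[zV zW]; rewrite zW andbT.
  by apply: contraNN zV; apply: inZ.
- rewrite muln_gt0; apply/andP; split; apply/card_gt0P.
    by exists x; rewrite !inE xV xX.
  by exists y; rewrite !inE yV yW.
Qed.

(** With [w x] the number of sets among [W] and [X] containing [x], such a [V] either misses a
    candidate of value 2 while holding a lesser one, or holds a candidate of value 0 and misses one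
    of [W]. *)
Let not_mid V : #|V| = k -> ~~ mid V ->
  exists x y, [/\ y \in V, x \notin V & (wt V < wt (x |: (V :\ y)))%N].
Proof.
move=> Vk; rewrite /mid Vk eqxx /= => nm.
pose w x := ((x \in W) + (x \in X))%N.
have wtE U : wt U = (\sum_(x in U) w x)%N.
  rewrite big_split /= /wt; congr (_ + _)%N; rewrite -sum1_card big_mkcond [RHS]big_mkcond;
  by apply: eq_bigr => x _; rewrite inE; case: (x \in U); case: (x \in _).
suff [x [y [yV xV wxy]]] : exists x y, [/\ y \in V, x \notin V & (w y < w x)%N].
  exists x, y; split=> //; rewrite !wtE big_setU1 ?inE ?(negbTE xV) ?andbF //=.
  by rewrite (big_setD1 y) //= ltn_add2r.
case: (boolP (V \subset W :|: X)) => VU; rewrite ?VU ?andbT in nm.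
  have [x] := fintype.subsetPn nm; rewrite inE => /andP[xW xX] xV.
  have : ~~ (V \subset W :&: X).
    apply: contraNN nm => h; suff -> : V = W :&: X by [].
    by apply/eqP; rewrite eqEcard h Vk -Wk subset_leq_card // subsetIl.
  move=> /fintype.subsetPn[y yV]; rewrite inE => yZ; exists x, y; split=> //.
  by rewrite /w xW xX; case: (y \in W) yZ; case: (y \in X).
have [y yV] := fintype.subsetPn VU; rewrite inE negb_or => /andP[yW yX].
have : ~~ (W \subset V).
  apply: contraNN VU => h; suff <- : W = V by rewrite subsetUl.
  by apply/eqP; rewrite eqEcard h Vk Wk leqnn.
move=> /fintype.subsetPn[x xW xV]; exists x, y; split=> //.
by rewrite /w (negbTE yW) (negbTE yX) xW.
Qed.

Lemma step_nonlinear v : W \in F v -> score s v X <= score s v W.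
Proof.
move=> Wv; rewrite leNgt; apply/negP => gap.
have [sg [Q [Y [kp [kp0 sgW [sgQ sgY] scQ scY]]]]] := symmetric_weights.
pose kY := kp * (k - 1)%:R.
have kY0 : 0 < kY by rewrite mulr_gt0 // ltr0n subn_gt0.
(* A large multiple of [Y] forces winners into [mid]: elsewhere some exchange gains at least
   [kY *+ N], which exceeds [b + b], the most that [u] can lose. *)
have loc u : exists N0, forall N, (N0 <= N)%N -> forall V, V \in F (u + Y *+ N) -> mid V.
  pose b := \sum_(V : {set 'I_m}) `|score s u V|.
  have b0 : 0 <= b by apply: sumr_ge0.
  have leb V : `|score s u V| <= b by rewrite /b (bigD1 V) //= lerDl sumr_ge0.
  have q0 : 0 <= (b + b) / kY by rewrite divr_ge0 ?addr_ge0 // ltW.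
  exists (Num.bound ((b + b) / kY)) => N hN V VF; apply: contraT => nm.
  have Vk := wr_card FR VF.
  have [x [y [yV xV lt]]] := not_mid Vk nm.
  have := score_exchange VF yV xV.
  rewrite !scoreD !scoreMn !scY ?card_exchange // -/kY => le.
  have bN : b + b < kY *+ N.
    rewrite -mulr_natr -ltr_pdivrMl // mulrC; apply: lt_le_trans (archi_boundP q0) _.
    by rewrite ler_nat.
  have step : kY *+ N <= (kY * (wt (x |: V :\ y))%:R) *+ N - (kY * (wt V)%:R) *+ N.
    rewrite -mulrnBl -mulrBr ler_wMn2r // ler_peMr ?(ltW kY0) // -natrB ?ler1n ?subn_gt0 //.
    exact: ltnW.
  have /ler_normlP[h1 _] := leb (x |: V :\ y); have /ler_normlP[_ h2] := leb V.
  lra.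
have wtW : wt W = (k + #|W :&: X|)%N := wt_mid midW.
have wtX : wt X = (k + #|W :&: X|)%N := wt_mid midX.
have QW : score s Q W = 0.
  by rewrite scQ // (_ : W :&: B = set0) ?cards0 ?muln0 ?mulr0 // setIDA setDIl setDv set0I.
have QX : score s Q X = 0.
  by rewrite scQ // (_ : X :&: A = set0) ?cards0 ?mul0n ?mulr0 // setIDA setDIl setDv set0I.
have midk V : mid V -> #|V| = k by case/and3P => /eqP.
have scYmid V : mid V -> score s Y V = score s Y W.
  by move=> mV; rewrite !scY ?midk // wtW wt_mid.
have WX : W != X.
  by apply: contraTneq t_ge2 => e; rewrite -WXt e setDv cards0.
(* [- Q] penalises the committees strictly between [W] and [X], and [Y] those
   outside their interval, so [F] elects exactly [W] and [X] here. *)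
have base al : exists N0, forall N, (N0 <= N)%N ->
    W \in F (- (Q *+ al.+1) + Y *+ N) /\ X \in F (- (Q *+ al.+1) + Y *+ N).
  have [N0 hN0] := loc (- (Q *+ al.+1)); exists N0 => N /hN0 {hN0}; set u := _ + _ => hN.
  (* The count is invariant under [sg], so [W] and [X] win together. *)
  have uX : (X \in F u) = (W \in F u).
    have uE : wact sg u = u by rewrite /u wactD wactN !wactMn sgQ sgY.
    by rewrite -sgW -{1}uE (wr_neutral FR).
  rewrite uX; suff WF : W \in F u by [].
  have [V VF] := set0Pn _ (wr_neq0 FR u); have mV := hN _ VF.
  have [<- //|VW] := eqVneq V W; have [e|VX] := eqVneq V X; first by rewrite -uX -e.
  (* A winner strictly between would score below [W], by its positive [Q]-score, against the
     induction hypothesis. *)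
  have [_ VWt _ hh] := midP mV VW VX.
  have := IH Wk VF VWt; rewrite !scoreD !scoreN !scoreMn QW (scYmid _ mV) lerD2r.
  rewrite mul0rn oppr0 oppr_ge0 (scQ _ (midk _ mV)) leNgt.
  by rewrite pmulrn_rgt0 // mulr_gt0 // ltr0n.
(* No intermediate committee has [Q]-score above [kp * (t * t)], so after scaling, one more copy of
   [Q] cannot lift it from at most the score of [W] to that of [X]. *)
have [n ngap] : exists n : nat, kp * (t * t)%:R < (score s v X - score s v W) *+ n.
  have g0 : 0 < score s v X - score s v W by rewrite subr_gt0.
  have q0 : 0 <= kp * (t * t)%:R / (score s v X - score s v W).
    by rewrite divr_ge0 ?mulr_ge0 // ltW.
  exists (Num.bound (kp * (t * t)%:R / (score s v X - score s v W))).
  by rewrite -[ltRHS]mulr_natr -ltr_pdivrMl // mulrC archi_boundP.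
pose v1 := v *+ n; have Wv1 : W \in F v1 := ruleMn FR n Wv.
have gap1 : score s v1 W + kp * (t * t)%:R < score s v1 X.
  by rewrite !scoreMn addrC -ltrBrDr -mulrnBl.
pose beats th := [exists M, [&& mid M, M != W, M != X &
  score s v1 W < score s (v1 + Q *+ th) M]].
(* A single exchange from [W] towards [X] stays short of [X] because [t >= 2]; its positive
   [Q]-score eventually overtakes [W]. *)
have ex_beats : exists th, beats th.
  have [a aA] : exists a, a \in A by apply/card_gt0P; rewrite cA ltnW.
  have [b bB] : exists b, b \in B by apply/card_gt0P; rewrite cB ltnW.
  pose M := b |: (W :\ a).
  have [aW aX] : a \in W /\ a \notin X by move: aA; rewrite inE => /andP[].
  have [bX bW] : b \in X /\ b \notin W by move: bB; rewrite inE => /andP[].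
  have mM : mid M.
    rewrite /mid card_exchange // Wk eqxx /=; apply/andP; split; apply/fintype.subsetP => x.
      by rewrite !inE => /andP[-> xX]; rewrite (contraTneq _ xX) ?orbT // => ->.
    by rewrite !inE => /orP[/eqP ->|/andP[_ ->]] //; rewrite bX orbT.
  have MW : M != W by apply: contraNneq bW => <-; rewrite !inE eqxx.
  have MX : M != X.
    have : (1 < #|A|)%N by rewrite cA.
    rewrite (cardsD1 a) aA ltnS => /card_gt0P[a']; rewrite !inE => /and3P[a'a a'X a'W].
    by apply: contraNneq a'X => <-; rewrite !inE a'a a'W orbT.
  have [_ _ _ hM] := midP mM MW MX.
  have QM : 0 < score s Q M by rewrite (scQ _ (midk _ mM)) mulr_gt0 // ltr0n.
  pose q := (score s v1 W - score s v1 M) / score s Q M.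
  exists (Num.bound `|q|); apply/existsP; exists M; rewrite mM MW MX /=.
  rewrite scoreD scoreMn -ltrBlDl -[ltRHS]mulr_natr -ltr_pdivrMl // mulrC -/q.
  by apply: le_lt_trans (ler_norm q) (archi_boundP _).
(* At the least [th] for which an intermediate committee overtakes [W], minimality
   keeps all of them below [X]. *)
case: (ex_minnP ex_beats) => th /existsP[M0 /and4P[mM0 M0W M0X M0lt]] th_min.
(* At [th = 0] the induction hypothesis keeps [W] ahead of intermediate committees. *)
have [th' thE] : exists th', th = th'.+1.
  case: th M0lt {th_min} => [|th' _]; last by exists th'.
  have [_ _ WM0t _] := midP mM0 M0W M0X.
  by rewrite mulr0n addr0 ltNge (IH (midk _ mM0) Wv1 WM0t).
have below_X M : mid M -> M != W -> M != X -> score s (v1 + Q *+ th) M < score s v1 X.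
  move=> mM MW MX; apply: le_lt_trans gap1.
  have le1 : score s (v1 + Q *+ th') M <= score s v1 W.
    rewrite leNgt; apply/negP => lt.
    have : beats th' by apply/existsP; exists M; rewrite mM MW MX.
    by move/th_min; rewrite thE ltnn.
  rewrite thE mulrSr addrA scoreD lerD // (scQ _ (midk _ mM)) ler_wpM2l ?(ltW kp0) // ler_nat leq_mul //.
    by rewrite -cA subset_leq_card // subsetIr.
  by rewrite -cB subset_leq_card // subsetIr.
have [N0 hN0] := loc (v1 + Q *+ th).
have [N2 hN2] := base th; have [N1 hN1] := base 0%N.
pose N := (N0 + N1)%N; pose v' := v1 + Q *+ th + Y *+ N.
(* [M0] outscores [W] here and is closer to [W] than [X] is. *)
have Wv' : W \notin F v'.
  apply/negP => Wv'; have [_ _ WM0t _] := midP mM0 M0W M0X.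
  have := IH (midk _ mM0) Wv' WM0t.
  rewrite scoreD [leRHS]scoreD !scoreMn (scYmid _ mM0) lerD2r leNgt.
  by rewrite [X in X < _]scoreD scoreMn QW mul0rn addr0 M0lt.
have Xv' : X \in F v'.
  have [V VF] := set0Pn _ (wr_neq0 FR v').
  have mV : mid V by apply: (hN0 N) => //; apply: leq_addr.
  have [e|VW] := eqVneq V W; first by rewrite -e VF in Wv'.
  have [<- //|VX] := eqVneq V X.
  have [VXt _ _ _] := midP mV VW VX.
  have := IH Xk VF VXt.
  rewrite scoreD [leRHS]scoreD !scoreMn (scYmid _ mV) (scYmid _ midX) lerD2r leNgt.
  by rewrite [X in _ < X]scoreD scoreMn QX mul0rn addr0 below_X.
(* The count added to [v'] uses [th.+1] copies of [- Q], leaving one after cancellation, so that the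
   sum is [v1] plus a count from [base 0]. [W] wins at both and hence at the sum; cancellation would
   make it win at [v']. *)
have [_ Xp2] := hN2 (N2 : nat) (leqnn N2).
have [|Wp1 _] := hN1 (N2 + N)%N; first by rewrite /N addnA leq_addl.
have /negP := Wv'; apply; apply: (rule_subl FR Xv' Xp2).
suff -> : v' + (- (Q *+ th.+1) + Y *+ N2) = v1 + (- (Q *+ 1) + Y *+ (N2 + N)).
  exact: (ruleD FR).
rewrite /v' addrACA [Q *+ th.+1]mulrSr opprD [v1 + _ + _]addrA addrK mulr1n -addrA.
by rewrite [Y *+ N + _]addrC -mulrnDr.
Qed.

End Step.

End NonLinear.

Lemma global_optimal v W X : W \in F v -> #|X| = k -> score s v X <= score s v W.
Proof.
case: (pselect (forall i, (i <= k)%N -> s i = s 1%N *+ i)) => [lin|nonlin].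
  exact: global_linear.
have ex : exists i, (i <= k)%N && (s i != s 1%N *+ i).
  apply: contrapT => no; apply: nonlin => i ik; apply/eqP; apply: contraT => ne.
  by case: no; exists i; rewrite ik.
case: (ex_minnP ex) => j /andP[jk jn] jmin.
have j_min i : (i < j)%N -> s i = s 1%N *+ i.
  move=> ij; apply/eqP; apply: contraT => ne.
  by have := jmin i; rewrite ne (leq_trans (ltnW ij) jk) leqNgt ij => /(_ isT).
have main t : forall v V V', #|V'| = k -> V \in F v -> (#|V :\: V'| < t)%N ->
    score s v V' <= score s v V.
  elim: t => // t IH u V V' V'k Vu; rewrite ltnS leq_eqVlt => /orP[/eqP VV't|]; last exact: IH.
  have Vk := wr_card FR Vu.
  have [t2|t2] := leqP 2 t; first exact: (step_nonlinear jk jn j_min t2 IH Vk V'k VV't).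
  (* At distance at most 1 the committees are equal or differ by one exchange, which is the adjacent
     case. *)
  have [->//|ne] := eqVneq V V'.
  have [Z [a [b [aZ bZ ab VE [bV' aV']]]]] := exchange_step (etrans Vk (esym V'k)) ne.
  have aV : a \in V by rewrite VE !inE eqxx.
  have bV : b \notin V by rewrite VE !inE [b == a]eq_sym (negbTE ab) (negbTE bZ).
  suff -> : V' = b |: (V :\ a) by apply: score_exchange.
  apply/eqP; rewrite eq_sym eqEcard card_exchange // Vk V'k leqnn andbT.
  apply/fintype.subsetP => x; rewrite !inE => /orP[/eqP -> //|/andP[xa xV]].
  apply: contraT => xV'; suff : (2 <= #|V :\: V'|)%N by rewrite VV't leqNgt t2.
  rewrite (cardsD1 a) !inE aV aV' ltnS; apply/card_gt0P; exists x.
  by rewrite !inE xa xV xV'.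
by move=> Wv Xk; apply: (main #|W :\: X|.+1).
Qed.

End Global.

(** * Score maximisers win *)

Section Argmax.
Local Open Scope ring_scope.
Variables (R : realType) (m k : nat).
Implicit Types (v w : weight m) (W X V : {set 'I_m}).

(** Continuity: some winner at [v *+ n + U] also wins at [v]. It must maximise the score there, and
    [W], optimal for [v], is strictly best for [U]. *)
Lemma rule_argmax (F : weight m -> {set {set 'I_m}}) (s : nat -> R) j v W :
  weight_rule k F -> {homo s : i j / (i <= j)%N >-> i <= j} ->
  (0 < j <= k)%N -> s j.-1 < s j ->
  (forall v W X, W \in F v -> #|X| = k -> score s v X <= score s v W) ->
  #|W| = k -> (forall X, #|X| = k -> score s v X <= score s v W) -> W \in F v.
Proof.
move=> FR smono /andP[j0 jk] sj glob Wk Wmax.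
(* [W] is the unique maximiser for [U]. *)
pose U := \sum_(D : {set 'I_m} | (D \subset W) && (#|D| == j)) one_ballot D.
have [n [n0 sub]] := wr_cont FR v U.
have [V VF] := set0Pn _ (wr_neq0 FR (v *+ n + U)).
have Vk := wr_card FR VF.
suff -> : W = V by apply: (fintype.subsetP sub).
apply/eqP; apply: contraT => WV.
have := glob _ _ _ VF Wk; rewrite !scoreD !scoreMn leNgt => /negP; case.
apply: ler_ltD; first by rewrite lerMn2r Wmax ?orbT.
have /fintype.subsetPn[x xW xV] : ~~ (W \subset V).
  by apply: contraNN WV => h; rewrite eqEcard h Wk Vk leqnn.
(* A ballot of [U] containing [x]: it has [j] members in [W] but at most [j.-1] in [V], and [s]
   increases strictly there. *)
pose D0 := x |: initial_subset (W :\ x) j.-1.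
have subW : initial_subset (W :\ x) j.-1 \subset W :\ x := initial_subset_sub _ _.
have D0W : D0 \subset W.
  by rewrite subUset sub1set xW (subset_trans subW) // subsetDl.
have D0j : #|D0| == j.
  rewrite cardsU1 (contraNN (fintype.subsetP subW x)) ?inE ?eqxx //.
  rewrite initial_subset_card ?add1n ?prednK //.
  by move: Wk; rewrite (cardsD1 x) xW; lia.
rewrite !score_sum (bigD1 D0) ?D0W //= [ltRHS](bigD1 D0) ?D0W //=.
apply: ltr_leD; rewrite ?score_one.
  rewrite (setIidPl D0W) (eqP D0j); apply: le_lt_trans (smono _ j.-1 _) sj.
  rewrite -ltnS prednK // -(eqP D0j); apply/proper_card/properP; split; first exact: subsetIl.
  by exists x; rewrite !inE ?eqxx ?(negbTE xV) ?andbF.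
apply: ler_sum => D /andP[/andP[DW _] _]; rewrite !score_one smono //.
by rewrite subset_leq_card // (setIidPl DW) subsetIl.
Qed.

End Argmax.

(** * Scores of profiles *)

Section ThieleScore.
Local Open Scope ring_scope.
Variables (R : realType) (m k : nat) (s : nat -> R).
Implicit Types (A B : ballots m) (W V X : {set 'I_m}) (l : seq {set 'I_m}).

Lemma thiele_scoreE A W :
  thiele_score s A W = \sum_(X <- ballot_seq A) s #|X :&: W|.
Proof.
rewrite /ballot_seq big_map big_seq_fsetE /=.
by apply: eq_bigr => x _; rewrite ballot_fsval.
Qed.

Definition ballot_count l : weight m := [ffun X => (count_mem X l)%:Z].

Lemma score_ballot_count l W :
  score s (ballot_count l) W = \sum_(X <- l) s #|X :&: W|.
Proof.
elim: l => [|X l IH].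
  by rewrite big_nil /score big1 // => X _; rewrite ffunE mulr0z.
rewrite big_cons -IH -score_one -scoreD; congr score; apply/ffunP => Y.
by rewrite weightD one_ballotE !ffunE /= PoszD eq_sym.
Qed.

Definition thiele_winners A : {set {set 'I_m}} :=
  [set W : {set 'I_m} | (#|W| == k) &&
    [forall W' : {set 'I_m}, (#|W'| == k) ==> (thiele_score s A W' <= thiele_score s A W)]].

Lemma thiele_winnersP A W : reflect
  (#|W| = k /\ forall V, #|V| = k -> thiele_score s A V <= thiele_score s A W)
  (W \in thiele_winners A).
Proof.
rewrite inE; apply: (iffP andP) => [[/eqP Wk /forallP h]|[Wk h]].
  by split=> // V /eqP Vk; have := h V; rewrite Vk.
by split; [apply/eqP | apply/forallP => V; apply/implyP => /eqP/h].
Qed.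

Lemma thiele_score_perm A l W : perm_eq (ballot_seq A) l ->
  thiele_score s A W = \sum_(X <- l) s #|X :&: W|.
Proof. by move=> p; rewrite thiele_scoreE (perm_big _ p). Qed.

Lemma thiele_score_cat A B W : disjoint_prof A B ->
  thiele_score s (catf A B) W = thiele_score s A W + thiele_score s B W.
Proof. by move=> d; rewrite (thiele_score_perm _ (ballot_seq_cat d)) big_cat !thiele_scoreE. Qed.

Lemma thiele_score_copies n A B W : copies n A B ->
  thiele_score s B W = thiele_score s A W *+ n.
Proof.
move=> /ballot_seq_copies/thiele_score_perm ->; rewrite thiele_scoreE.
elim: n => [|n IH] /=; first by rewrite big_nil mulr0n.
by rewrite big_cat /= IH mulrS.
Qed.

End ThieleScore.

(** * Thiele rules satisfy the axioms *)

Section ThieleAxioms.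
Local Open Scope ring_scope.
Variables (R : realType) (m k : nat) (f : ballots m -> {set {set 'I_m}}) (s : nat -> R).
Hypothesis s_scoring : is_thiele_scoring k s.
Hypothesis fE : forall A, is_profile A -> f A = thiele_winners k s A.
Implicit Types (A B : ballots m) (W V X : {set 'I_m}).

Lemma thiele_anonymous : anonymous f.
Proof.
move=> pi A B bpi pA rAB; have p := ballot_seq_relabel bpi rAB.
have pB : is_profile B by rewrite is_profile_valid (valid_perm p) -is_profile_valid.
have e W : thiele_score s B W = thiele_score s A W.
  by rewrite (thiele_score_perm _ _ p) -thiele_scoreE.
rewrite !fE //; apply/setP => W; rewrite !inE; congr (_ && _).
by apply: eq_forallb => V; rewrite !e.
Qed.

Lemma cat_profile A B : disjoint_prof A B -> is_profile A -> is_profile B ->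
  is_profile (catf A B).
Proof.
move=> d; rewrite !is_profile_valid (valid_perm (ballot_seq_cat d)).
exact: valid_cat.
Qed.

Lemma thiele_neutral : neutral f.
Proof.
move=> tau A pA; have pB : is_profile (cand_perm tau A).
  by move: pA; rewrite !is_profile_valid ballot_seq_cand_perm valid_map.
have e W : thiele_score s (cand_perm tau A) (tau @: W) = thiele_score s A W.
  rewrite !thiele_scoreE ballot_seq_cand_perm big_map; apply: eq_bigr => X _.
  rewrite -imsetI ?card_imset //; first exact: perm_inj.
  by move=> x y _ _; apply: perm_inj.
have ck W : #|tau @: W| = #|W| by rewrite card_imset //; apply: perm_inj.
rewrite !fE //; apply/setP => W; rewrite -(imsetKVp tau W).
rewrite [RHS]mem_imset; last exact: imset_perm_inj.
move: (_ @: W) => {}W; apply/thiele_winnersP/thiele_winnersP; rewrite ck => -[Wk h]; split=> // V Vk.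
  by rewrite -(e V) -(e W) h // ck.
by rewrite -(imsetKVp tau V) !e h // -[LHS]ck imsetKVp.
Qed.

(** The common winner [W0] attains both maxima, so a maximiser of the sum must attain both as
    well. *)
Lemma thiele_consistent : consistent f.
Proof.
move=> A B pA pB d; rewrite !fE ?cat_profile // => /set0Pn[W0].
rewrite inE => /andP[/thiele_winnersP[W0k hA] /thiele_winnersP[_ hB]].
apply/setP => W; rewrite [RHS]inE.
apply/thiele_winnersP/andP => [[Wk h]|[/thiele_winnersP[Wk h1] /thiele_winnersP[_ h2]]].
  have := h _ W0k; rewrite !thiele_score_cat // => le0.
  have a1 := hA _ Wk; have b1 := hB _ Wk.
  by split; apply/thiele_winnersP; split=> // V Vk; [have := hA _ Vk | have := hB _ Vk]; lra.
by split=> // V Vk; rewrite !thiele_score_cat // lerD ?h1 ?h2.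
Qed.

Lemma thiele_continuous : continuous f.
Proof.
move=> A A' pA pA'.
pose b := \sum_(V : {set 'I_m}) `|thiele_score s A' V|.
have leb V : `|thiele_score s A' V| <= b by rewrite /b (bigD1 V) //= lerDl sumr_ge0.
have b0 : 0 <= b by apply: sumr_ge0.
(* Copies needed for the gap between two committees to outweigh [A']; ties give 0 since [x / 0 = 0].
   Summing over all pairs gives one [n] for all. *)
pose q (p : {set 'I_m} * {set 'I_m}) :=
  (b + b) / `|thiele_score s A p.2 - thiele_score s A p.1|.
pose n := (\sum_p Num.bound (q p)).+1; exists n; split=> // B cB d.
have pB : is_profile B.
  rewrite is_profile_valid (valid_perm (ballot_seq_copies cB)) valid_copies //.
  by rewrite -is_profile_valid.
rewrite !fE ?cat_profile //; apply/fintype.subsetP => W /thiele_winnersP[Wk h].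
apply/thiele_winnersP; split=> // V Vk; rewrite leNgt; apply/negP => gap.
have g0 : 0 < thiele_score s A V - thiele_score s A W by rewrite subr_gt0.
have qn : q (W, V) < n%:R.
  apply: lt_le_trans (archi_boundP _) _; first by rewrite divr_ge0 ?addr_ge0.
  by rewrite ler_nat /n (bigD1 (W, V)) //= ltnW // ltnS leq_addr.
move: qn; rewrite /q /= gtr0_norm // ltr_pdivrMr // mulr_natl mulrnBl.
have := h _ Vk; rewrite !thiele_score_cat // !(thiele_score_copies _ _ cB).
have /ler_normlP[_ h1] := leb W; have /ler_normlP[h2 _] := leb V.
lra.
Qed.

(** The score of [W] is unchanged, while shrinking ballots cannot raise the score of any other
    committee. *)
Lemma thiele_indep_losers : indep_losers f.
Proof.
have [_ smono] := s_scoring.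
move=> A A' W pA pA' dA h; rewrite !fE // => /thiele_winnersP[Wk Wmax].
have sE (C : ballots m) V : thiele_score s C V = \sum_(i <- domf C) s #|ballot C i :&: V|.
  by rewrite thiele_scoreE /ballot_seq big_map.
have hb i : i \in domf A -> ballot A' i \subset ballot A i /\ W :&: ballot A' i = W :&: ballot A i.
  by move=> iA; apply: (h i iA); rewrite fnd_ballot // -dA.
apply/thiele_winnersP; split=> // V Vk.
have -> : thiele_score s A' W = thiele_score s A W.
  rewrite !sE -dA big_seq [RHS]big_seq; apply: eq_bigr => i iA.
  by have [_ e] := hb i iA; rewrite setIC e setIC.
apply: le_trans (Wmax _ Vk); rewrite !sE -dA big_seq [leRHS]big_seq; apply: ler_sum => i iA.
have [sub _] := hb i iA; apply: smono.
by rewrite subset_leq_card ?setSI //= -Vk subset_leq_card // subsetIr.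
Qed.

End ThieleAxioms.

Theorem theorem1 (R : realType) (m k : nat) (f : ballots m -> {set {set 'I_m}}) :
  (2 <= m)%N -> (1 <= k)%N -> (k <= m - 1)%N -> is_ABC_rule k f ->
  (is_thiele_rule R k f <->
   [/\ anonymous f, neutral f, consistent f, continuous f & indep_losers f]).
Proof.
move=> m2 k1 km fABC; split=> [[s [ss fE]]|[fan fneu fcons fcont find]].
  split; [exact: (thiele_anonymous fE) | exact: (thiele_neutral fE)
    | exact: (thiele_consistent fE) | exact: (thiele_continuous fE)
    | exact: (thiele_indep_losers ss fE)].
have m0 : (0 < m)%N by apply: ltnW.
pose g := list_rule f; pose F := extend g.
have g_neq0 := list_rule_neq0 fABC.
have g_card := list_rule_card fABC.
have g_perm := @list_rule_perm _ f fan.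
have g_cat := list_rule_cat fan fcons.
have g_neu := list_rule_neu fan fneu.
have FR : weight_rule k F.
  apply: extend_weight_rule => //; first exact: (list_rule_cont fan fcont).
  exact: (list_rule_ind find).
(* A profile represents its own counts with surplus 0. *)
have fF A : is_profile A -> f A = F (ballot_count (ballot_seq A)).
  move=> pA; rewrite (list_ruleE fan pA).
  apply/esym/(@extendE _ _ _ m0 g_neq0 g_card g_perm g_cat g_neu _ _ 0).
  by split=> [|X _]; rewrite -?is_profile_valid // ffunE addr0.
(* If every committee always wins, the zero scoring function serves; otherwise some pair of adjacent
   committees is separated and yields [s]. *)
have [[v0 [W0 [W0k W0v]]]|triv] := pselect (exists v (W : {set 'I_m}), #|W| = k /\ W \notin F v).
  have [s [s0 smono [j [jk sj]] adj]] := @adjacent_scoring R _ _ _ FR _ _ W0k W0v.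
  exists s; split; first by split=> // i j' /andP[ij _]; apply: smono.
  move=> A pA; rewrite fF //; apply/setP => W; rewrite -/(thiele_winners k s A).
  have glob := global_optimal FR s0 adj.
  have scE V : thiele_score s A V = score s (ballot_count (ballot_seq A)) V.
    by rewrite score_ballot_count thiele_scoreE.
  apply/idP/thiele_winnersP => [WF|[Wk Wmax]].
    by split=> [|V Vk]; rewrite ?(wr_card FR WF) // !scE glob.
  by apply: (rule_argmax FR smono jk sj glob Wk) => V Vk; rewrite -!scE Wmax.
exists (fun=> 0%R); split; first by split.
move=> A pA; rewrite fF //; apply/setP => W; rewrite -/(thiele_winners k (fun=> 0%R : R) A).
have sc0 V : thiele_score (fun=> 0%R : R) A V = 0%R by apply: big1.
apply/idP/thiele_winnersP => [WF|[Wk _]].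
  by split=> [|V _]; rewrite ?(wr_card FR WF) // !sc0.
by apply: contraT => WF; case: triv; exists (ballot_count (ballot_seq A)), W.
Qed.
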